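(* For a sequence of positive integers $h=(1,2,h_2,\ldots,h_s)$ (with $h_0=1$, $h_1=2$, $s\geq 1$, and $h_{s+1}=0$), the following are equivalent: (i) There is a matroid $\Delta$ such that $h$ is the $h$-vector of $\Bbbk[\Delta]$. (ii) There is a matroid $\Delta$ such that $h$ is the $h$-vector of $S/J(\Delta)$. (iii) $h$ is a pure $O$-sequence. (iv) $h$ is the $h$-vector of a level algebra. (v) $h_{i+1}\le 2h_i-h_{i-1}$ for all $i=1,\ldots,s$.
   Context: $\Bbbk$ is a field. A matroid on $[n]=\{1,\ldots,n\}$ is identified with its simplicial complex $\Delta$ of independent sets (a simplicial complex such that for $F,G\in\Delta$ with $|F|<|G|$ there is $i\in G\setminus F$ with $F\cup\{i\}\in\Delta$). $S=\Bbbk[x_1,\ldots,x_n]$; $I_\Delta=(\prod_{i\in F}x_i : F\subseteq [n],\ F\notin\Delta)$, $\Bbbk[\Delta]=S/I_\Delta$, and $J(\Delta)=\bigcap_{F\text{ facet of }\Delta}(x_i : i\in F)$ is the cover ideal. The $h$-vector of a standard graded $\Bbbk$-algebra $A$ is the coefficient vector of the polynomial $h(t)$ with Hilbert series of $A$ equal to $h(t)/(1-t)^{\dim A}$. A level algebra is a standard graded Cohen–Macaulay $\Bbbk$-algebra such that the socle of its Artinian reduction is concentrated in a single degree. An order ideal is a finite set of monomials closed under taking divisors; it is pure if its maximal monomials all have the same degree; a pure $O$-sequence is the vector counting by degree the monomials of a pure order ideal. *)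

(* Defs.v *)
From HB Require Import structures.
From mathcomp Require Import all_boot all_order all_algebra.
From mathcomp Require Import finmap.
From mathcomp Require Import mpoly.

Set Implicit Arguments.
Unset Strict Implicit.
Unset Printing Implicit Defensive.

Import GRing.Theory.
Local Open Scope ring_scope.

Section Ideals.
Variable R : comNzRingType.
Implicit Types (I P : R -> Prop) (s : seq R).

Definition is_ideal I : Prop :=
  [/\ I 0, forall p q, I p -> I q -> I (p + q) & forall a p, I p -> I (a * p)].

Definition prime_ideal P : Prop :=
  [/\ is_ideal P, ~ P 1 & forall p q, P (p * q) -> P p \/ P q].

Definition ideal_gen (G : R -> Prop) : R -> Prop := fun p =>
  exists cs : seq (R * R),
    (forall c, c \in cs -> G c.2) /\ p = \sum_(c <- cs) c.1 * c.2.

(* The ideal I + (s); it presents the quotient of R/I by the classes of s. *)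
Definition adjoin I s : R -> Prop := ideal_gen (fun p => I p \/ p \in s).

(* Chains C 0 < C 1 < ... < C d of primes containing I, i.e. chains of length d
   in Spec (R/I). *)
Definition prime_chain I (d : nat) (C : nat -> R -> Prop) : Prop :=
  (forall i, (i <= d)%N -> prime_ideal (C i) /\ (forall p, I p -> C i p)) /\
  (forall i, (i < d)%N ->
     (forall p, C i p -> C i.+1 p) /\ (exists p, C i.+1 p /\ ~ C i p)).

(* The Krull dimension of R/I is d. *)
Definition krull_dim I (d : nat) : Prop :=
  (exists C, prime_chain I d C) /\
  (forall e C, prime_chain I e C -> (e <= d)%N).

(* The sequence s is regular on R/I. *)
Definition regular_seq I s : Prop :=
  ~ adjoin I s 1 /\
  (forall i, (i < size s)%N ->
     forall p, adjoin I (take i s) (s`_i * p) -> adjoin I (take i s) p).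

End Ideals.

Section GradedAlgebras.
Variables (k : fieldType) (n : nat).
Implicit Types (I : {mpoly k[n]} -> Prop) (h : seq nat).

(* Standard graded k-algebras are presented as S/I with S = k[x_1, .., x_n] and
   I a proper homogeneous ideal; I may contain linear forms. *)
Definition homogeneous_ideal I : Prop :=
  is_ideal I /\ (forall d p, I p -> I (pihomog mdeg d p)).

Definition standard_graded I : Prop := homogeneous_ideal I /\ ~ I 1.

(* dim_k (S/I)_i = m : some m forms of degree i induce a basis of (S/I)_i. *)
Definition dim_component I (i m : nat) : Prop :=
  exists b : 'I_m -> {mpoly k[n]},
    [/\ forall j, b j \is i.-homog,
        forall p, p \is i.-homog ->
          exists c : 'I_m -> k, I (p - \sum_j c j *: b j)
      & forall c : 'I_m -> k, I (\sum_j c j *: b j) -> forall j, c j = 0].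

(* The Hilbert series sum_i (HF i) t^i of S/I equals h(t) / (1 - t)^d with
   d = dim S/I; as power series, (1 - t)^d * sum_i (HF i) t^i = h(t). *)
Definition h_vector I h : Prop :=
  exists (d : nat) (HF : nat -> nat),
    [/\ krull_dim I d,
        forall i, dim_component I i (HF i)
      & forall m, \sum_(j < m.+1)
            ((1 - 'X) ^+ d : {poly int})`_j * (HF (m - j)%N)%:Z
          = (nth 0%N h m)%:Z].

(* The depth of S/I is e, the regular sequences being taken in the irrelevant
   maximal ideal (x_1, .., x_n). *)
Definition depth I (e : nat) : Prop :=
  let reg s := (forall f, f \in s -> f@_0%MM = 0) /\ regular_seq I s in
  (exists s, size s = e /\ reg s) /\ (forall s, reg s -> (size s <= e)%N).

Definition cohen_macaulay I : Prop := exists d, krull_dim I d /\ depth I d.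

Definition socle I : {mpoly k[n]} -> Prop := fun p => forall i, I ('X_i * p).

Definition socle_in_single_degree I : Prop :=
  exists c : nat, forall p, socle I p -> exists2 q, q \is c.-homog & I (p - q).

End GradedAlgebras.

(* The ideal defining (S/I) (x)_k K. *)
Definition base_change (k K : fieldType) (f : {rmorphism k -> K}) (n : nat)
    (I : {mpoly k[n]} -> Prop) : {mpoly K[n]} -> Prop :=
  ideal_gen (fun q => exists2 p, I p & q = map_mpoly f p).

(* An Artinian reduction is the quotient by a regular sequence of dim S/I linear
   forms. Over a finite field there may be no such sequence, so it is taken, as
   usual, after an extension of scalars; whether its socle lies in a single
   degree depends neither on the extension nor on the linear forms. *)
Definition level_algebra (k : fieldType) (n : nat)
    (I : {mpoly k[n]} -> Prop) : Prop :=
  [/\ standard_graded I, cohen_macaulay I &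
      exists (K : fieldType) (f : {rmorphism k -> K}) (s : seq {mpoly K[n]}),
        let IK := base_change f I in
        [/\ krull_dim I (size s),
            forall l, l \in s -> l \is 1.-homog,
            regular_seq IK s
          & socle_in_single_degree (adjoin IK s)]].

Section Matroids.
Variable n : nat.
Implicit Types D : {set {set 'I_n}}.

Definition simplicial_complex D : Prop :=
  set0 \in D /\ (forall F G : {set 'I_n}, F \in D -> G \subset F -> G \in D).

Definition matroid D : Prop :=
  simplicial_complex D /\
  (forall F G, F \in D -> G \in D -> (#|F| < #|G|)%N ->
     exists2 i, i \in G :\: F & i |: F \in D).

Definition facet D (F : {set 'I_n}) : bool := maxset (fun G => G \in D) F.

Definition stanley_reisner_ideal (k : fieldType) D : {mpoly k[n]} -> Prop :=
  ideal_gen (fun p =>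
    exists2 F : {set 'I_n}, F \notin D & p = \prod_(i in F) 'X_i).

Definition cover_ideal (k : fieldType) D : {mpoly k[n]} -> Prop := fun p =>
  forall F, facet D F -> ideal_gen (fun q => exists2 i, i \in F & q = 'X_i) p.

End Matroids.

Section PureOSequences.
Variable n : nat.
Implicit Types (G : {fset 'X_{1..n}}) (m : 'X_{1..n}).

(* A monomial is its exponent vector; (m1 <= m2)%MM is divisibility. *)
Definition order_ideal G : Prop :=
  forall m1 m2, m2 \in G -> (m1 <= m2)%MM -> m1 \in G.

Definition maximal_monomial G m : Prop :=
  m \in G /\ (forall m', m' \in G -> (m <= m')%MM -> m' = m).

Definition pure G : Prop :=
  forall m1 m2, maximal_monomial G m1 -> maximal_monomial G m2 ->
    mdeg m1 = mdeg m2.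

End PureOSequences.

Definition pure_O_sequence (h : seq nat) : Prop :=
  exists (n : nat) (G : {fset 'X_{1..n}}),
    [/\ order_ideal G, pure G
      & forall i, nth 0%N h i = #|` [fset m in G | mdeg m == i]%fset |].

(* Main.v *)
(**
  The first link is duality: the Stanley-Reisner ideal of a matroid is the cover
  ideal of the dual matroid.

  A matroid D of rank r on n elements is governed, through its cover ideal, by
  d = dim S/J(D) = n - r and h_1 = r - c, where c is the number of coloops. So
  h_1 = 2 means that D is, up to coloops, a matroid of rank 2, which is given by
  the sizes a_1, .., a_m of its parallel classes. With N = sum a_j one finds
      (1 - t)^2 h(t) = 1 - sum_j t^(N - a_j) + (m - 1) t^N,
  so that N = s + 2 and the second differences of h are nonpositive below s + 2.
  Conversely, a concave h is turned into sizes a_j by conjugating the partition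
  formed by the numbers h_(s-u) - h_(s-u+1) + 1; this gives a matroid, and also
  a pure order ideal in two variables: the staircase with corners (e, s - e),
  for e + 1 running over the partial sums of the a_j other than N.

  The monomials of a pure order ideal span an Artinian level algebra. Finally,
  the Artinian reduction A of a level algebra has Hilbert function h, and if x,
  y span A_1, then the Koszul complex A_(i-1) -> A_i^2 -> A_(i+1) is injective
  on the left, since the socle of A lives in degree s, and surjective on the
  right; hence h_(i-1) + h_(i+1) <= 2 h_i.

  The dimension of a Stanley-Reisner ring is bounded from above without
  transcendence degrees: any r + 1 elements are algebraically dependent by
  counting monomials, whereas elements x_i of C_(i+1) outside C_i, for a chain
  of primes C_i, are algebraically independent.
*)

Require Import Defs.
From HB Require Import structures.
From mathcomp Require Import all_boot all_order all_algebra.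
From mathcomp Require Import finmap.
From mathcomp Require Import mpoly.
From mathcomp Require Import zify ring.

Set Implicit Arguments.
Unset Strict Implicit.
Unset Printing Implicit Defensive.

Local Open Scope ring_scope.

Import GRing.Theory.

(** * Ideals and their graded components *)

Section LinearPredicates.
Variables (k : fieldType) (U V : lmodType k) (f : U -> V).
Hypothesis fL : linear f.

Lemma linear_pred0 : f 0 = 0.
Proof.
pose F : {linear U -> V} := HB.pack f (GRing.isLinear.Build k U V *:%R f fL).
exact: (linear0 F).
Qed.

Lemma linear_predD u v : f (u + v) = f u + f v.
Proof. by rewrite -[u in LHS]scale1r fL scale1r. Qed.

Lemma linear_predZ a u : f (a *: u) = a *: f u.
Proof. by rewrite -[a *: u]addr0 fL linear_pred0 addr0. Qed.

Lemma linear_predB u v : f (u - v) = f u - f v.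
Proof. by rewrite -scaleN1r linear_predD linear_predZ scaleN1r. Qed.

Lemma linear_pred_sum (J : Type) (r : seq J) (P : pred J) (E : J -> U) :
  f (\sum_(j <- r | P j) E j) = \sum_(j <- r | P j) f (E j).
Proof.
pose F : {linear U -> V} := HB.pack f (GRing.isLinear.Build k U V *:%R f fL).
exact: (linear_sum F).
Qed.

End LinearPredicates.

Section Ideals.
Variable R : comNzRingType.
Implicit Types (I G : R -> Prop) (s : seq R).

Lemma idealN I p : is_ideal I -> I p -> I (- p).
Proof. by case=> _ _ IM Ip; rewrite -mulN1r; apply: IM. Qed.

Lemma idealB I p q : is_ideal I -> I p -> I q -> I (p - q).
Proof. by move=> II Ip Iq; case: (II) => _ ID _; apply: ID => //;
  apply: idealN. Qed.

Lemma ideal_sum I (J : eqType) (r : seq J) (P : pred J) (F : J -> R) :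
  is_ideal I -> (forall j, j \in r -> P j -> I (F j)) ->
  I (\sum_(j <- r | P j) F j).
Proof.
case=> I0 ID _ IF; rewrite big_seq_cond;
  apply: (big_ind I) => // j /andP[jr Pj].
exact: IF.
Qed.

Lemma ideal_genP G : is_ideal (ideal_gen G).
Proof.
split=> [|p q [cs [Gc ->]] [cs' [Gc' ->]]|a p [cs [Gc ->]]].
- by exists [::]; rewrite big_nil.
- exists (cs ++ cs'); rewrite big_cat; split=> // c.
  by rewrite mem_cat => /orP[/Gc|/Gc'].
- exists [seq (a * c.1, c.2) | c <- cs]; split=> [c /mapP[c' c'cs ->]|].
    exact: Gc c'cs.
  by rewrite big_map mulr_sumr; apply: eq_bigr => c _; rewrite mulrA.
Qed.

Lemma mem_ideal_gen G p : G p -> ideal_gen G p.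
Proof.
move=> Gp; exists [:: (1, p)]; split=> [c|]; first by rewrite inE => /eqP->.
by rewrite big_seq1 mul1r.
Qed.

Lemma ideal_gen_min G I : is_ideal I -> (forall p, G p -> I p) ->
  forall p, ideal_gen G p -> I p.
Proof.
move=> II GI p [cs [Gcs ->]]; apply: ideal_sum => // c /Gcs /GI Ic _.
by case: II => _ _; apply.
Qed.

Lemma adjoin_nil I p : is_ideal I -> adjoin I [::] p <-> I p.
Proof.
move=> II; split=> [|Ip]; last by apply: mem_ideal_gen; left.
by apply: ideal_gen_min => // q [].
Qed.

(** Reduces the quotient by a sequence to successive quotients by one element, in the shape that
    [dim_component_nonzerodivisor] produces. *)
Lemma adjoin_rcons I s l p :
  adjoin I (rcons s l) p <-> exists q, adjoin I s (p - l * q).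
Proof.
have IA t : is_ideal (adjoin I t) by apply: ideal_genP.
split.
  pose J p := exists q, adjoin I s (p - l * q).
  apply: (@ideal_gen_min _ J) => [|q [Iq|]].
  - split=> [|a b [q aq] [q' bq']|a b [q bq]].
    + by exists 0; rewrite mulr0 subr0; case: (IA s).
    + exists (q + q'); rewrite mulrDr opprD addrACA.
      by case: (IA s) => _ ID _; apply: ID.
    + exists (a * q); rewrite mulrCA -mulrBr.
      by case: (IA s) => _ _ IM; apply: IM.
  - by exists 0; rewrite mulr0 subr0; apply: mem_ideal_gen; left.
  - rewrite mem_rcons inE => /predU1P[->|qs].
      by exists 1; rewrite mulr1 subrr; case: (IA s).
    by exists 0; rewrite mulr0 subr0; apply: mem_ideal_gen; right.
case=> q sq; rewrite -[p](subrK (l * q)).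
case: (IA (rcons s l)) => _ ID IM; apply: ID; last first.
  by rewrite mulrC; apply/IM/mem_ideal_gen; right; rewrite mem_rcons mem_head.
apply: ideal_gen_min sq => // r [Ir|rs]; apply: mem_ideal_gen; first by left.
by right; rewrite mem_rcons inE rs orbT.
Qed.

End Ideals.

Section Coordinates.
Variables (k : fieldType) (n : nat).
Implicit Types (I : {mpoly k[n]} -> Prop) (p q : {mpoly k[n]}).

Lemma idealZ I c p : is_ideal I -> I p -> I (c *: p).
Proof. by case=> _ _ IM Ip; rewrite -mul_mpolyC; apply: IM. Qed.

Lemma dhomog_mpolyE i p : p \is i.-homog ->
  p = \sum_(m : 'X_{1..n < i.+1} | mdeg m == i) p@_m *: 'X_[m].
Proof.
move=> pi; rewrite -[LHS](pihomog_dE pi) (@pihomogwE _ _ mdeg i i.+1) //.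
by rewrite msizeE; apply/bigmax_leqP_seq => m mp _; rewrite (dhomog_mf pi).
Qed.

(* [coords I i m phi] says that phi induces an isomorphism (S/I)_i = k^m. *)
Definition coords I i m (phi : {mpoly k[n]} -> 'rV[k]_m) : Prop :=
  [/\ linear phi,
      forall p, p \is i.-homog -> phi p = 0 <-> I p
    & forall v, exists2 p, p \is i.-homog & phi p = v].

Lemma coords_lift I i m phi : @coords I i m phi ->
  exists2 b : 'I_m -> {mpoly k[n]}, (forall j, b j \is i.-homog) &
    forall v : 'rV_m, phi (\sum_j v 0 j *: b j) = v.
Proof.
case=> phiL _ phi_onto.
have /fin_all_exists2[b bi phib] j := phi_onto (delta_mx 0 j).
exists b => // v; rewrite linear_pred_sum // [RHS]row_sum_delta.
by apply: eq_bigr => j _; rewrite linear_predZ // phib.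
Qed.

Lemma homog_comb i m (b : 'I_m -> {mpoly k[n]}) (c : 'I_m -> k) :
  (forall j, b j \is i.-homog) -> \sum_j c j *: b j \is i.-homog.
Proof. by move=> bi; apply: rpred_sum => j _; apply: rpredZ. Qed.

(** A basis is traded for a coordinate map, so that ranks of matrices become available. Given a
    basis, coordinates are chosen for each monomial of degree i and extended linearly; [phi] reads
    only the coefficients in degree i, hence is linear on all polynomials. *)
Lemma dim_componentP I i m : is_ideal I ->
  dim_component I i m <-> exists phi, @coords I i m phi.
Proof.
move=> II; split=> [[b [bi bgen bfree]]|[phi cphi]]; last first.
  have [phiL phiI _] := cphi; have [b bi phib] := coords_lift cphi.
  exists b; split=> // [p pi|c Ic j].
    exists (phi p 0); apply/phiI; last by rewrite linear_predB // phib subrr.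
    by apply: rpredB => //; apply: homog_comb.
  have: phi (\sum_j (\row_j c j) 0 j *: b j) = 0.
    apply/phiI; first exact: homog_comb.
    by under eq_bigr do rewrite mxE.
  by rewrite phib => /rowP/(_ j); rewrite !mxE.
have /fin_all_exists[c cP] (x : 'X_{1..n < i.+1}) : exists c : 'I_m -> k,
    mdeg x = i -> I ('X_[x] - \sum_j c j *: b j).
  have [xi|xi] := eqVneq (mdeg x) i; last by exists (fun=> 0) => eq_xi;
    rewrite eq_xi eqxx in xi.
  by have [|c Ic] := bgen 'X_[x]; [rewrite dhomogX; apply/eqP | exists c].
pose phi p := \sum_(x : 'X_{1..n < i.+1} | mdeg x == i) p@_x *: \row_j c x j.
have phiL : linear phi.
  move=> a p q; rewrite /phi scaler_sumr -big_split; apply: eq_bigr => x _.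
  by rewrite mcoeffD mcoeffZ scalerDl scalerA.
have phiE p : p \is i.-homog -> I (p - \sum_j phi p 0 j *: b j).
  move=> pi; have -> : p - \sum_j phi p 0 j *: b j =
      \sum_(x : 'X_{1..n < i.+1} | mdeg x == i)
         p@_x *: ('X_[x] - \sum_j c x j *: b j).
    rewrite [in LHS](dhomog_mpolyE pi).
    under [RHS]eq_bigr do rewrite scalerBr.
    rewrite sumrB; congr (_ - _).
    under [RHS]eq_bigr do rewrite scaler_sumr.
    rewrite exchange_big; apply: eq_bigr => j _;
      rewrite /phi summxE scaler_suml.
    rewrite -(dhomog_mpolyE pi).
    by apply: eq_bigr => x _; rewrite !mxE scalerA.
  by apply: ideal_sum => // x _ /eqP/cP; apply: idealZ.
have phib (v : 'rV_m) : phi (\sum_j v 0 j *: b j) = v.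
  apply/rowP => j; apply/eqP; rewrite -subr_eq0; apply/eqP.
  set p := \sum_j v 0 j *: b j.
  rewrite -oppr0 -[LHS]opprK opprB; congr (- _).
  apply: (bfree (fun j => v 0 j - phi p 0 j)).
  under eq_bigr do rewrite scalerBl.
  by rewrite sumrB; apply: phiE; apply: homog_comb.
exists phi; split=> // [p pi|v]; last by exists (\sum_j v 0 j *: b j);
  rewrite ?homog_comb.
have Ip := phiE p pi; split=> [phi0|Ipp].
  rewrite -[p]subr0; move: Ip; rewrite phi0 [\sum_j _]big1 // => j _.
  by rewrite mxE scale0r.
apply/rowP => j; rewrite mxE; apply: bfree.
by rewrite -[\sum_j _](subKr p); apply: idealB.
Qed.

(** The map [g] factors through (S/I)_i; the rows of [A] are its values on lifts of the unit
    vectors. *)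
Lemma coords_induced I i m phi m' (g : {mpoly k[n]} -> 'rV[k]_m') :
  @coords I i m phi -> is_ideal I -> linear g ->
  (forall p, p \is i.-homog -> I p -> g p = 0) ->
  exists A, forall p, p \is i.-homog -> g p = phi p *m A.
Proof.
move=> cphi II gL gI; have [phiL phiI _] := cphi.
have [b bi phib] := coords_lift cphi.
exists (\matrix_j g (b j)) => p pi.
set q := \sum_j phi p 0 j *: b j; have qi : q \is i.-homog by apply: homog_comb.
have : g (p - q) = 0.
  by apply: gI; rewrite ?rpredB //; apply/phiI;
    rewrite ?rpredB // linear_predB // phib subrr.
rewrite linear_predB // => /eqP; rewrite subr_eq0 => /eqP ->.
rewrite linear_pred_sum // mulmx_sum_row; apply: eq_bigr => j _.
by rewrite linear_predZ // rowK.
Qed.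

Lemma coords_uniq I i m m' phi phi' : is_ideal I ->
  @coords I i m phi -> @coords I i m' phi' -> m = m'.
Proof.
move=> II; wlog suff le_m : m m' phi phi' / @coords I i m phi -> @coords I i m'
  phi' -> (m' <= m)%N.
  by move=> c c'; apply/eqP;
    rewrite eqn_leq (le_m _ _ _ _ c c') (le_m _ _ _ _ c' c).
move=> c c'; have [phiL' phiI' onto'] := c'.
have [p pi|A phiA] := coords_induced c II phiL'.
  by move/(phiI' p pi).
have /eqP <- : row_full A.
  apply/row_fullP; have [b bi phib'] := coords_lift c'.
  exists (\matrix_j phi (b j)); apply/row_matrixP => j.
  rewrite row_mul rowK -phiA // row1 -[RHS]phib'; congr phi'.
  rewrite (bigD1 j) //= big1 ?addr0 => [|l lj]; rewrite mxE ?eqxx ?scale1r //.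
  by rewrite (negPf lj) andbF scale0r.
exact: rank_leq_row.
Qed.

Lemma dim_component_uniq I i m m' : is_ideal I ->
  dim_component I i m -> dim_component I i m' -> m = m'.
Proof.
move=> II /(dim_componentP _ _ II)[phi c] /(dim_componentP _ _ II)[phi' c'].
exact: coords_uniq c c'.
Qed.

End Coordinates.

(** * Homogeneous ideals and multiplication by linear forms *)

Section HomogeneousIdeals.
Variables (k : fieldType) (n : nat).
Implicit Types (I G : {mpoly k[n]} -> Prop) (p q : {mpoly k[n]}).

Lemma mcoeff_pihomog d p m :
  (pihomog mdeg d p)@_m = if mdeg m == d then p@_m else 0.
Proof.
rewrite [p in RHS]mpolyE pihomogE !raddf_sum /= big_mkcond /=.
have [md|md] := eqVneq (mdeg m) d; [apply: eq_bigr|apply: big1] => x _;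
  case: ifP => // /eqP xd; rewrite ?mcoeff0 // mcoeffZ mcoeffX;
  by case: eqP => [xm|]; rewrite ?mulr0 //; move: xd md; rewrite xm => // ->;
    rewrite ?eqxx.
Qed.

Lemma pihomogMl d e p q : p \is e.-homog ->
  pihomog mdeg d (p * q) = if (e <= d)%N then p * pihomog mdeg (d - e) q else 0.
Proof.
move=> pe; rewrite {1}(pihomog_partitionE (leqnn (mmeasure mdeg q))).
rewrite mulr_sumr raddf_sum /=.
have pqj (j : nat) : p * pihomog mdeg j q \is (e + j).-homog.
  by apply: dhomogM => //; apply: pihomogP.
case: leqP => ed; last first.
  rewrite big1 // => j _; apply: pihomog_ne0 (pqj j).
  by rewrite gtn_eqF // ltn_addr.
have [lt_de|le_de] := ltnP (d - e) (msize q).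
  rewrite (bigD1 (Ordinal lt_de)) //= [X in _ + X]big1 ?addr0.
    by rewrite pihomog_dE // -[d in d.-homog](subnKC ed).
  move=> j /eqP jde; apply: pihomog_ne0 (pqj j); apply/eqP => de; apply: jde.
  by apply: val_inj => /=; rewrite -de addKn.
have -> : pihomog mdeg (d - e) q = 0.
  apply/mpolyP => m; rewrite mcoeff_pihomog mcoeff0; case: eqP => // md.
  by apply/memN_msupp_eq0/msize_mdeg_ge; rewrite md.
rewrite mulr0 big1 // => j _; apply: pihomog_ne0 (pqj j).
by have := ltn_ord j; lia.
Qed.

(** The polynomials all of whose components lie in [ideal_gen G] form an ideal, so checking the
    generators is enough. *)
Lemma homogeneous_ideal_gen G :
  (forall d p, G p -> ideal_gen G (pihomog mdeg d p)) ->
  homogeneous_ideal (ideal_gen G).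
Proof.
move=> Gh; have [I0 ID IM] := ideal_genP G; split=> // d p Gp; move: d.
apply: (@ideal_gen_min _ G (fun p =>
  forall d, ideal_gen G (pihomog mdeg d p))) Gp => [|q Gq d];
  last exact: Gh.
split=> [d|q r Iq Ir d|a q Iq d]; first by rewrite pihomog0.
  by rewrite pihomogD; apply: ID.
rewrite (pihomog_partitionE (leqnn (mmeasure mdeg a))) mulr_suml raddf_sum.
apply: ideal_sum => //= e _ _; rewrite (pihomogMl _ _ (pihomogP _ _ _)).
by case: ifP => // _; apply: IM.
Qed.

Lemma homogeneous_adjoin I s : homogeneous_ideal I ->
  (forall l, l \in s -> l \is 1.-homog) -> homogeneous_ideal (adjoin I s).
Proof.
move=> [II Ih] sh; apply: homogeneous_ideal_gen => d p [Ip|ps].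
  by apply: mem_ideal_gen; left; apply: Ih.
have [d1|/eqP d1] := eqVneq 1%N d.
  by rewrite -d1 pihomog_dE; [apply: mem_ideal_gen; right | apply: sh].
rewrite (pihomog_ne0 _ (sh p ps)); last exact/eqP.
by case: (ideal_genP (fun p => I p \/ p \in s)).
Qed.

Section LinearForm.
Variables (I : {mpoly k[n]} -> Prop) (l : {mpoly k[n]}).
Hypotheses (Ih : homogeneous_ideal I) (l1 : l \is 1.-homog).

Let II : is_ideal I := proj1 Ih.

Lemma coords_mull i m m' phi phi' :
  @coords k n I i m phi -> @coords k n I i.+1 m' phi' ->
  exists A, forall p, p \is i.-homog -> phi' (l * p) = phi p *m A.
Proof.
move=> c [phiL' phiI' _]; have [_ _ IM] := II.
apply: (coords_induced (g := fun p => phi' (l * p)) c) => //.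
  by move=> a p q; rewrite mulrDr -scalerAr phiL'.
by move=> p pi Ip; apply/phiI'; [apply: (dhomogM l1 pi) | apply: IM].
Qed.

Hypothesis l_reg : forall p, I (l * p) -> I p.

(** This is the exact sequence 0 -> (S/I)_(i-1) -> (S/I)_i -> (S/(I + (l)))_i -> 0, whose first map
    is multiplication by [l]. Stating it as a sum avoids truncated subtraction. *)
Lemma dim_component_nonzerodivisor (HF : nat -> nat) :
  (forall i, dim_component I i (HF i)) ->
  forall i, exists2 m, (HF i = m + (if i is j.+1 then HF j else 0))%N &
    dim_component (fun p => exists q, I (p - l * q)) i m.
Proof.
move=> HFP; pose J p := exists q, I (p - l * q).
have [I0 ID IM] := II.
have IJ : is_ideal J.
  split=> [|p q [r Ir] [t It]|a p [r Ir]].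
  - by exists 0; rewrite mulr0 subr0.
  - by exists (r + t); rewrite mulrDr opprD addrACA; apply: ID.
  - by exists (a * r); rewrite mulrCA -mulrBr; apply: IM.
(* For homogeneous p in I + (l), the cofactor of [l] can be replaced by its component of degree i -
   1, which is zero if i = 0. *)
have Jh i p : p \is i.-homog -> J p ->
    exists2 q, I (p - l * q) & if i is j.+1 then q \is j.-homog else q = 0.
  move=> pi [q Iq]; have := proj2 Ih i _ Iq; rewrite pihomogB pihomog_dE //.
  rewrite (pihomogMl _ _ l1); case: i pi => [|i] pi /=.
    by exists 0; rewrite ?mulr0.
  by rewrite subSS subn0; exists (pihomog mdeg i q) => //; apply: pihomogP.
move=> [|i].
  exists (HF 0%N); first by rewrite addn0.
  have /dim_componentP[//|phi [phiL phiI phi_onto]] := HFP 0%N.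
  apply/(dim_componentP _ _ IJ); exists phi; split=> // p p0; split.
    by move/(phiI p p0); exists 0; rewrite mulr0 subr0.
  by case/(Jh _ _ p0) => q; rewrite /= => Iq q0; apply/(phiI p p0); move: Iq;
    rewrite q0 mulr0 subr0.
have /dim_componentP[//|phi c] := HFP i.
have /dim_componentP[//|phi' c'] := HFP i.+1.
have [A phiA] := coords_mull c c'.
have [phiL phiI phi_onto] := c; have [phiL' phiI' phi_onto'] := c'.
have rkA : \rank A = HF i.
  apply/eqP/row_freeP.
  suff /eqP : row_free A by move=> /eqP/row_freeP.
  rewrite -kermx_eq0 -submx0; apply/rV_subP => v /sub_kermxP.
  have [p pi <-] := phi_onto v; rewrite -phiA // => /phiI'.
  by move=> /(_ (dhomogM l1 pi))/l_reg/phiI -> //; apply: sub0mx.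
exists (\rank (cokermx A)).
  by rewrite mxrank_coker rkA subnK // -rkA rank_leq_col.
apply/(dim_componentP _ _ IJ).
(* The left kernel of [cokermx A] is the row space of [A], the image of multiplication by [l];
   [col_base] keeps this kernel and cuts the target down to the dimension of the cokernel. *)
exists (fun p => phi' p *m col_base (cokermx A)); split.
- by move=> a p q; rewrite phiL' mulmxDl -scalemxAl.
- move=> p pi; split.
    move/(congr1 (mulmx^~ (row_base (cokermx A)))).
    rewrite -mulmxA mulmx_base mul0mx => /eqP; rewrite -submxE.
    case/submxP => v pv; have [q qi qv] := phi_onto v; exists q; apply/phiI'.
      by rewrite rpredB // (dhomogM l1 qi).
    by rewrite linear_predB // phiA // qv pv subrr.
  case/(Jh _ _ pi) => q Iq qi.
  have -> : phi' p = phi' (l * q).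
    apply/eqP; rewrite -subr_eq0 -linear_predB //; apply/eqP/phiI' => //.
    by rewrite rpredB // (dhomogM l1 qi).
  apply: (row_free_inj (row_base_free (cokermx A))).
  by rewrite /= -mulmxA mulmx_base phiA // -mulmxA mulmx_coker mulmx0 mul0mx.
- move=> v; have /row_fullP[B Bv] := col_base_full (cokermx A).
  have [p pi pv] := phi_onto' (v *m B); exists p => //.
  by rewrite pv -mulmxA Bv mulmx1.
Qed.

End LinearForm.

Section Koszul.
Variables (I : {mpoly k[n]} -> Prop) (HF : nat -> nat).
Hypotheses (Ih : homogeneous_ideal I)
           (HFP : forall i, dim_component I i (HF i)) (HF1 : HF 1%N = 2%N).

(* The Koszul complex A_(i-1) -> A_i^2 -> A_(i+1) on two linear forms x, y that
   span A_1 is injective on the left because A has no socle in degree i - 1, and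
   surjective on the right because A is standard graded. *)
Lemma koszul_concave i : (forall p, p \is i.-homog -> socle I p -> I p) ->
  (HF i + HF i.+2 <= HF i.+1 + HF i.+1)%N.
Proof.
move=> socle0; have II := proj1 Ih; have [I0 ID IM] := II.
have /dim_componentP[//|phi1 c1] := HFP 1%N.
move: HF1 phi1 c1 => -> phi1 c1.
have [b b1 phib] := coords_lift c1; have [phiL1 phiI1 _] := c1.
have /dim_componentP[//|phi c] := HFP i.
have /dim_componentP[//|phi' c'] := HFP i.+1.
have /dim_componentP[//|phi'' c''] := HFP i.+2.
have [phiL phiI phi_onto] := c; have [phiL' phiI' phi_onto'] := c'.
have [phiL'' phiI'' phi_onto''] := c''.
set x := b 0; set y := b 1.
have bE t : exists a, exists a', I ('X_t - (a *: x + a' *: y)).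
  exists (phi1 'X_t 0 0), (phi1 'X_t 0 1).
  have -> : phi1 'X_t 0 0 *: x + phi1 'X_t 0 1 *: y = \sum_j phi1 'X_t 0 j *: b
    j.
    rewrite big_ord_recl big_ord1; congr (_ + _ *: _); first congr (phi1 _ _ _).
      by apply/val_inj.
    by congr b; apply/val_inj.
  have Xt : 'X_t \is [in k[n], 1.-homog] by rewrite dhomogX; apply/eqP/mdeg1.
  by apply/phiI1; rewrite ?rpredB ?homog_comb // linear_predB // phib subrr.
have [Ax AxE] := coords_mull Ih (b1 0) c c'.
have [Ay AyE] := coords_mull Ih (b1 1) c c'.
have [Bx BxE] := coords_mull Ih (b1 0) c' c''.
have [By ByE] := coords_mull Ih (b1 1) c' c''.
have free : row_free (row_mx Ay (- Ax)).
  rewrite -kermx_eq0 -submx0; apply/rV_subP => v /sub_kermxP.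
  have [p pi <-] := phi_onto v; rewrite mul_mx_row -row_mx0 mulmxN.
  case/eq_row_mx; rewrite -AyE // => /(phiI' _ (dhomogM (b1 1) pi)) Iy /eqP.
  rewrite oppr_eq0 -AxE // => /eqP/(phiI' _ (dhomogM (b1 0) pi)) Ix.
  suff /(socle0 p pi)/(phiI p pi) -> : socle I p by apply: sub0mx.
  move=> t; have [a [a' It]] := bE t.
  rewrite -['X_t](subrK (a *: x + a' *: y)) mulrDl [X in _ + X]mulrDl;
    apply: (ID).
    by rewrite mulrC; apply: IM.
  rewrite -!scalerAl; by apply: (ID); apply: idealZ => //; rewrite ?Ix ?Iy.
have full : row_full (col_mx Bx By).
  rewrite -sub1mx; apply/rV_subP => v _; have [p pi <-] := phi_onto'' v.
  rewrite (dhomog_mpolyE pi) linear_pred_sum //.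
  (* A monomial of positive degree is divisible by some variable, which is a combination of [x] and
     [y] modulo I. *)
  apply: summx_sub => m /eqP mi; rewrite linear_predZ // scalemx_sub //.
  have [t mt] : exists t, (0 < m t)%N.
    apply/existsP; apply: contra_eqT mi => /existsPn m0.
    by rewrite mdegE big1 // => t _; apply/eqP; rewrite -leqn0 leqNgt m0.
  have mE : (bmnm m = U_(t) + (m - U_(t)))%MM.
    by rewrite addmC submK // lep1mP -lt0n.
  have qi : 'X_[m - U_(t)] \is [in k[n], (i.+1).-homog].
    rewrite dhomogX; apply/eqP/succn_inj.
    by rewrite -[RHS]mi [in RHS]mE mdegD mdeg1.
  have [a [a' It]] := bE t; set q := 'X_[_] in qi.
  rewrite mE mpolyXD -/q.
  have -> : phi'' ('X_t * q) = a *: phi'' (x * q) + a' *: phi'' (y * q).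
    rewrite -!(linear_predZ phiL'') -(linear_predD phiL''); apply/eqP.
    rewrite -subr_eq0 -(linear_predB phiL''); apply/eqP/phiI''.
      have Xt : 'X_t \is [in k[n], 1.-homog] by rewrite dhomogX;
        apply/eqP/mdeg1.
      by apply: rpredB; [|apply: rpredD; apply: rpredZ];
        apply: (dhomogM (d := 1) _ qi) => //; apply: b1.
    by rewrite !scalerAl -mulrDl -mulrBl mulrC; apply: IM.
  rewrite BxE // ByE //; apply: addmx_sub; apply/scalemx_sub/mulmx_sub.
    by rewrite -[X in (X <= _)%MS]mul1mx -(addsmxE Bx By) ?mul1mx addsmxSl.
  by rewrite -(addsmxE Bx By) addsmxSr.
have complex : row_mx Ay (- Ax) *m col_mx Bx By = 0.
  rewrite mul_row_col mulNmx; apply/row_matrixP => j.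
  rewrite row0 rowE mulmxBr; have [p pi <-] := phi_onto (delta_mx 0 j).
  have [yp xp] := (dhomogM (b1 1) pi, dhomogM (b1 0) pi).
  by rewrite !mulmxA -AyE // -AxE // -BxE // -ByE // mulrCA subrr.
(* The ranks of two matrices with product zero add up to at most the middle dimension, here twice
   [HF i.+1]. *)
have := mulmx0_rank_max complex.
by rewrite (eqP free) (eqP full).
Qed.

End Koszul.
End HomogeneousIdeals.

(** * Level algebras of codimension two *)

Section BaseChange.
Variables (k K : fieldType) (f : {rmorphism k -> K}) (n : nat).
Variable I : {mpoly k[n]} -> Prop.
Hypothesis Ih : homogeneous_ideal I.

Let II : is_ideal I := proj1 Ih.

Lemma homogeneous_base_change : homogeneous_ideal (base_change f I).
Proof.
apply: homogeneous_ideal_gen => d q [p Ip ->]; apply: mem_ideal_gen.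
exists (pihomog mdeg d p); first exact: (proj2 Ih).
apply/mpolyP => m; rewrite mcoeff_pihomog !mcoeff_map_mpoly mcoeff_pihomog.
by case: ifP => // _; rewrite raddf0.
Qed.

Lemma dim_component_base_change i m :
  dim_component I i m -> dim_component (base_change f I) i m.
Proof.
have IK : is_ideal (base_change f I) by apply: ideal_genP.
case/(dim_componentP _ _ II) => phi c; have [phiL phiI phi_onto] := c.
have [b bi phib] := coords_lift c; have [_ _ IM] := II.
pose psi (q : {mpoly K[n]}) : 'rV[K]_m :=
  \sum_(x : 'X_{1..n < i.+1} | mdeg x == i) q@_x *: map_mx f (phi 'X_[x]).
have psiL : linear psi.
  move=> a p q; rewrite /psi scaler_sumr -big_split; apply: eq_bigr => x _.
  by rewrite mcoeffD mcoeffZ scalerDl scalerA.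
have psi_map p : psi (map_mpoly f p) = map_mx f (phi (pihomog mdeg i p)).
  rewrite (dhomog_mpolyE (pihomogP mdeg i p)) (linear_pred_sum phiL) map_mx_sum.
  apply: eq_bigr => x xi; rewrite mcoeff_map_mpoly (linear_predZ phiL) map_mxZ.
  by rewrite mcoeff_pihomog xi.
(* By linearity it suffices to treat a monomial times the image of some p in I; there [psi] is the
   image under f of a value of [phi] on I, because I is homogeneous. *)
have psi0 q : base_change f I q -> psi q = 0.
  case=> cs [Ics ->]; rewrite (linear_pred_sum psiL) big_seq big1 // => -[a g].
  move/Ics => /= [p Ip ->]; rewrite (mpolyE a) mulr_suml (linear_pred_sum psiL).
  rewrite big1 // => x _; rewrite -scalerAl (linear_predZ psiL).
  rewrite -(map_mpolyX f) -rmorphM /= psi_map.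
  rewrite (proj2 (phiI _ (pihomogP _ _ _))) ?map_mx0 ?scaler0 //.
  exact/(proj2 Ih)/IM.
have fb j : map_mpoly f (b j) \is i.-homog.
  apply/dhomogP => x; rewrite mcoeff_msupp mcoeff_map_mpoly => /eqP fx.
  apply: (dhomog_mf (bi j)); rewrite mcoeff_msupp; apply/eqP => bx.
  by apply: fx; rewrite bx raddf0.
apply/(dim_componentP _ _ IK); exists psi; split=> // [q qi|v].
  split=> [psiq|]; last exact: psi0.
  (* The part of q along the basis vanishes because [psi q = 0], which leaves a combination of
     images of elements of I. *)
  have -> : q = \sum_(x : 'X_{1..n < i.+1} | mdeg x == i)
      q@_x *: map_mpoly f ('X_[x] - \sum_j phi 'X_[x] 0 j *: b j).
    rewrite [LHS](dhomog_mpolyE qi).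
    under [RHS]eq_bigr do rewrite rmorphB /= map_mpolyX scalerBr.
    rewrite sumrB [X in _ - X](_ : _ = 0) ?subr0 //.
    under eq_bigr do rewrite (raddf_sum (map_mpoly f)) scaler_sumr.
    rewrite exchange_big big1 // => j _ /=.
    under eq_bigr do rewrite map_mpolyZ scalerA.
    rewrite -scaler_suml (_ : \sum_(_ | _) _ = psi q 0 j).
      by rewrite psiq mxE scale0r.
    by rewrite /psi summxE; apply: eq_bigr => x _; rewrite !mxE.
  apply: ideal_sum => // x _ xi; apply: idealZ => //; apply: mem_ideal_gen.
  eexists; last reflexivity; apply/phiI.
    by rewrite rpredB ?homog_comb // dhomogX.
  by rewrite linear_predB // phib subrr.
exists (\sum_j v 0 j *: map_mpoly f (b j)); first exact: homog_comb.
rewrite linear_pred_sum // [RHS]row_sum_delta; apply: eq_bigr => j _.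
rewrite linear_predZ // psi_map pihomog_dE //; congr (_ *: _).
rewrite -[b j](_ : \sum_l (delta_mx 0 j : 'rV_m) 0 l *: b l = _).
  by rewrite phib map_delta_mx.
rewrite (bigD1 j) //= big1 ?addr0 => [|l lj]; rewrite mxE ?eqxx ?scale1r //.
by rewrite (negPf lj) andbF scale0r.
Qed.

End BaseChange.

Lemma krull_dim_uniq (R : comNzRingType) (I : R -> Prop) d e :
  krull_dim I d -> krull_dim I e -> d = e.
Proof.
move=> [[C Cd] led] [[C' Ce] lee]; apply/eqP.
by rewrite eqn_leq (lee _ _ Cd) (led _ _ Ce).
Qed.

(** A truncated Hilbert series: identities of power series are checked on the coefficients below M,
    which the truncation does not affect in products. *)
Definition hilbert_poly (HF : nat -> nat) (M : nat) : {poly int} :=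
  \poly_(i < M) (HF i)%:Z.

Lemma coef_hilbert_poly (P : {poly int}) HF M m : (m < M)%N ->
  (P * hilbert_poly HF M)`_m = \sum_(j < m.+1) P`_j * (HF (m - j)%N)%:Z.
Proof.
move=> mM; rewrite coefM; apply: eq_bigr => j _; rewrite coef_poly.
by rewrite (leq_ltn_trans (leq_subr _ _)).
Qed.

Section RegularSequence.
Variables (k : fieldType) (n : nat) (I : {mpoly k[n]} -> Prop).
Variables (s : seq {mpoly k[n]}) (HF : nat -> nat).
Hypotheses (Ih : homogeneous_ideal I) (s_reg : regular_seq I s)
  (s1 : forall l, l \in s -> l \is 1.-homog)
  (HFP : forall i, dim_component I i (HF i)).

(** Each linear nonzerodivisor multiplies the Hilbert series by 1 - t; induction along the
    sequence. *)
Lemma dim_component_regular_seq : exists2 HA : nat -> nat,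
    forall i, dim_component (adjoin I s) i (HA i)
  & forall m M, (m < M)%N ->
      ((1 - 'X) ^+ size s * hilbert_poly HF M)`_m = (HA m)%:Z.
Proof.
have II := proj1 Ih.
suff [HA HAP HAE] : exists2 HA : nat -> nat,
    forall i, dim_component (adjoin I (take (size s) s)) i (HA i)
  & forall m M, (m < M)%N ->
      ((1 - 'X) ^+ size s * hilbert_poly HF M)`_m = (HA m)%:Z.
  by exists HA => //; rewrite -{1}[s]take_size.
move: {-2}(size s) (leqnn (size s)); elim=> [_|j IHj j_lt].
  exists HF => [i|m M mM]; last by rewrite expr0 mul1r coef_poly mM.
  have [b [bi bgen bfree]] := HFP i; exists b; split=> // [p pi|c].
    by have [c Ic] := bgen p pi; exists c; rewrite take0; apply/adjoin_nil.
  by rewrite take0 => /adjoin_nil Ic; apply: bfree; apply: Ic.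
have [HA HAP HAE] := IHj (ltnW j_lt).
have Ihj : homogeneous_ideal (adjoin I (take j s)).
  by apply: homogeneous_adjoin => // l /mem_take; apply: s1.
have sj1 : s`_j \is 1.-homog by apply/s1/mem_nth.
have [_ /(_ _ j_lt) sj_reg] := s_reg.
have HA'P := dim_component_nonzerodivisor Ihj sj1 sj_reg HAP.
(* This subtraction never truncates, since [HA'P] writes [HA i] as a sum with the subtracted
   term. *)
exists (fun i => HA i - (if i is i'.+1 then HA i' else 0))%N => [i|m M mM].
  have [m -> [b [bi bgen bfree]]] := HA'P i; rewrite addnK; exists b.
  rewrite (take_nth 0 j_lt); split=> // [p pi|c /adjoin_rcons];
    last exact: bfree.
  by have [c Ic] := bgen p pi; exists c; apply/adjoin_rcons.
rewrite exprS -mulrA mulrBl mul1r coefB coefXM HAE //.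
have [m' -> _] := HA'P m; rewrite addnK.
case: m mM => [|m] mM; rewrite ?subr0 ?addn0 //=.
by rewrite HAE ?(ltnW mM) // PoszD addrK.
Qed.

End RegularSequence.

Theorem level_concave (k : fieldType) (n : nat) (I : {mpoly k[n]} -> Prop)
    (s : nat) (h : seq nat) :
  size h = s.+1 -> (forall i, (i <= s)%N -> (0 < nth 0%N h i)%N) ->
  nth 0%N h 1 = 2%N -> level_algebra I -> h_vector I h ->
  forall i, (i < s)%N ->
    (nth 0%N h i + nth 0%N h i.+2 <= nth 0%N h i.+1 + nth 0%N h i.+1)%N.
Proof.
move=> size_h h_pos h1 [[Ih _] _ [K [f [t [dimI t1 t_reg socleA]]]]].
case=> d [HF [dimId HFP hE]]; have IhK := homogeneous_base_change f Ih.
have HFPK i := dim_component_base_change f Ih (HFP i).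
have [HA HAP HAE] := dim_component_regular_seq IhK t_reg t1 HFPK.
have {}HAE m : HA m = nth 0%N h m.
  apply/eqP; rewrite -eqz_nat -(HAE m m.+1) // coef_hilbert_poly //.
  by rewrite (krull_dim_uniq dimI dimId) hE.
have Ah := homogeneous_adjoin IhK t1; set A := adjoin _ t in Ah HAP socleA.
have AP i : dim_component A i (nth 0%N h i) by rewrite -HAE.
have [c cP] := socleA; have [IA Ah'] := Ah.
(* A_s is nonzero as h_s > 0, and it lies in the socle as A_(s+1) = 0; hence the socle degree is
   s. *)
have c_s : c = s.
  have /dim_componentP[//|phi [phiL phiI phi_onto]] := AP s.
  have [p ps phip] := phi_onto (const_mx 1).
  have A'p : ~ A p.
    move/(phiI p ps); rewrite phip => /rowP/(_ (Ordinal (h_pos s (leqnn s)))).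
    by rewrite !mxE => /eqP; rewrite oner_eq0.
  have [|q qc Apq] := cP p.
    move=> j; have /dim_componentP[//|phi' [_ phiI' _]] := AP s.+1.
    have : 'X_j * p \is (s.+1).-homog.
      by rewrite -[s.+1]add1n dhomogM // dhomogX; apply/eqP/mdeg1.
    move=> Xp; apply/(phiI' _ Xp); apply/rowP => -[l l_lt].
    by exfalso; move: l_lt; rewrite nth_default ?size_h.
  have [//|/eqP cs] := eqVneq c s; case: A'p.
  have := Ah' s _ Apq; rewrite pihomogB (pihomog_dE ps) (pihomog_ne0 _ qc)
    ?subr0 //.
  exact/eqP.
(* A socle form of degree i < s is congruent to a form of degree s; comparing components in degree i
   puts it into the ideal. *)
move=> i i_s; apply: (koszul_concave Ah AP h1) => p pi /cP[q].
rewrite c_s => qs /(Ah' i);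
  rewrite pihomogB (pihomog_dE pi) (pihomog_ne0 _ qs) ?subr0 //.
by rewrite gtn_eqF.
Qed.

(** * Monomial ideals *)

Section MonomialIdeals.
Variables (k : fieldType) (n : nat).
Implicit Types (P : pred 'X_{1..n}) (m : 'X_{1..n}) (p q : {mpoly k[n]}).

(* P is the set of the standard monomials, those outside the ideal. *)
Definition monomial_ideal P p : Prop := forall m, P m -> p@_m = 0.

Definition divisor_closed P : Prop :=
  forall m1 m2, P m2 -> (m1 <= m2)%MM -> P m1.

Lemma homogeneous_monomial_ideal P :
  divisor_closed P -> homogeneous_ideal (monomial_ideal P).
Proof.
move=> Pdiv; split=> [|d p Ip m Pm]; last first.
  by rewrite mcoeff_pihomog Ip // if_same.
split=> [m _|p q Ip Iq m Pm|a p Ip m Pm]; first by rewrite mcoeff0.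
  by rewrite mcoeffD Ip // Iq // addr0.
rewrite mcoeffM big1 // => x /eqP mE; rewrite Ip ?mulr0 //.
by apply: Pdiv Pm _; rewrite [X in (_ <= X)%MM]mE lem_addl.
Qed.

Lemma dim_component_monomial_ideal P (i : nat) (r : seq 'X_{1..n}) :
  uniq r -> (forall m, (m \in r) = P m && (mdeg m == i)) ->
  dim_component (monomial_ideal P) i (size r).
Proof.
move=> r_uniq rE; pose b (j : 'I_(size r)) : {mpoly k[n]} := 'X_[nth 0%MM r j].
have coef_b (c : 'I_(size r) -> k) (j : 'I_(size r)) :
    (\sum_j c j *: b j)@_(nth 0%MM r j) = c j.
  rewrite raddf_sum (bigD1 j) //= big1 ?addr0 => [|l lj].
    by rewrite mcoeffZ mcoeffX eqxx mulr1.
  by rewrite mcoeffZ mcoeffX nth_uniq // -[_ == _]/(l == j) (negPf lj) mulr0.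
exists b; split=> [j|p pi|c Ic j].
- have := mem_nth 0%MM (ltn_ord j); rewrite rE => /andP[_ ri].
  by rewrite dhomogX.
- exists (fun j => p@_(nth 0%MM r j)) => m Pm; apply/eqP.
  rewrite mcoeffB subr_eq0; apply/eqP.
  have [mi|mi] := eqVneq (mdeg m) i; last first.
    rewrite (dhomog_nemf_coeff pi mi) (@dhomog_nemf_coeff _ _ mdeg i) //.
    apply: homog_comb => j; have := mem_nth 0%MM (ltn_ord j).
    by rewrite rE dhomogX => /andP[].
  have mr : m \in r by rewrite rE Pm mi eqxx.
  rewrite -(nth_index 0%MM mr).
  have := mr; rewrite -index_mem => mi'.
  exact/esym/(coef_b (fun j => p@_(nth 0%MM r j)) (Ordinal mi')).
- rewrite -(coef_b c j) Ic //.
  by have := mem_nth 0%MM (ltn_ord j); rewrite rE => /andP[].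
Qed.

End MonomialIdeals.

Lemma map_mpoly_id (k : fieldType) (n : nat) (p : {mpoly k[n]}) :
  map_mpoly idfun p = p.
Proof. by apply/mpolyP => m; rewrite mcoeff_map_mpoly. Qed.

Lemma base_change_id (k : fieldType) (n : nat) (I : {mpoly k[n]} -> Prop) p :
  is_ideal I -> base_change idfun I p <-> I p.
Proof.
move=> II; split=> [|Ip]; last first.
  by apply: mem_ideal_gen; exists p; rewrite ?map_mpoly_id.
by apply: ideal_gen_min => // q [r Ir ->]; rewrite map_mpoly_id.
Qed.

(** * The level algebra of a pure order ideal *)

Section ArtinianMonomialAlgebra.
Variables (k : fieldType) (n : nat) (G : {fset 'X_{1..n}}).
Hypotheses (Gdiv : order_ideal G) (G0 : 0%MM \in G).

Let I : {mpoly k[n]} -> Prop := monomial_ideal (mem G).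

Let Ih : homogeneous_ideal I.
Proof. by apply: homogeneous_monomial_ideal => m1 m2; apply: Gdiv. Qed.

Let II : is_ideal I := proj1 Ih.

Lemma standard_graded_order_ideal : standard_graded I.
Proof.
split=> // /(_ 0%MM G0); rewrite mcoeff1 eqxx => /eqP.
by rewrite oner_eq0.
Qed.

Lemma exists_maximal_monomial : exists m, maximal_monomial G m.
Proof.
have [m mG m_max] : exists2 m, m \in G &
    forall m', m' \in G -> (mdeg m' <= mdeg m)%N.
  pose x0 : G := [` G0]%fset; pose x := [arg max_(y > x0) mdeg (val y)].
  exists (val x); first exact: valP.
  move=> m' m'G; rewrite /x; case: arg_maxnP => // y _ y_max.
  exact: (y_max [` m'G]%fset).
exists m; split=> // m' m'G m_le; rewrite -(submK m_le).
have: (mdeg (m' - m + m) <= mdeg m)%N by rewrite submK // m_max.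
rewrite mdegD -[X in (_ <= X)%N]add0n leq_add2r leqn0 mdeg_eq0 => /eqP ->.
by rewrite add0m.
Qed.

(** As G is finite, I contains a power of each variable. Hence any prime over I contains every
    polynomial without constant term, and these already form a maximal ideal. *)
Lemma krull_dim_order_ideal : krull_dim I 0.
Proof.
pose maxI (p : {mpoly k[n]}) := p@_0%MM = 0.
have maxP : prime_ideal maxI.
  split=> [|/eqP|p q /eqP].
  - split=> [|p q p0 q0|a p p0]; rewrite /maxI ?mcoeff0 //.
      by rewrite mcoeffD p0 q0 addr0.
    by rewrite (rmorphM (mcoeff 0%MM)) /= p0 mulr0.
  - by rewrite mcoeff1 eqxx oner_eq0.
  - rewrite (rmorphM (mcoeff 0%MM)) mulf_eq0.
    by case/orP=> /eqP; [left | right].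
split=> [|[//|e] C [CP CS]].
  exists (fun=> maxI); split=> // i _; split=> // p; exact.
have Xn (i : 'I_n) : exists N, I ('X_i ^+ N).
  exists (\max_(x : G) mdeg (val x)).+1 => m mG; rewrite mcoeffXn.
  case: eqP => // mE; have := leq_bigmax (F := fun x : G =>
    mdeg (val x)) [` mG]%fset.
  by rewrite /= -mE mdegMn mdeg1 mul1n ltnn.
have sub_max j : (j <= e.+1)%N -> forall p, maxI p -> C j p.
  move=> je p p0; have [[[C0 CD CM] C1 Cpr] CI] := CP j je.
  have CX i : C j 'X_i.
    have [N /CI] := Xn i; elim: N => [|N IHN]; first by rewrite expr0.
    by rewrite exprS => /Cpr[].
  rewrite (mpolyE p); apply: ideal_sum => // m _ _.
  have [->|m0] := eqVneq m 0%MM; first by rewrite p0 scale0r.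
  apply: idealZ => //; have /existsP[i mi] : [exists i, m i != 0%N].
    apply: contraNT m0 => /existsPn m0; apply/eqP/mnmP => i.
    by rewrite mnm0E; apply/eqP/negPn/m0.
  rewrite -(@submK _ U_(i)%MM m) ?lep1mP // mpolyXD.
  exact: CM.
have [sub01 [p [Cp nCp]]] := CS 0%N isT.
have [[[C0 CD CM] C1 _] _] := CP 1%N isT.
case: nCp; apply: (sub_max) => //; rewrite /maxI; apply/eqP/negPn/negP => p0.
(* If p had a nonzero constant term, that constant would lie in [C 1%N], and so would 1. *)
have Cq : C 1%N (p - (p@_0%MM)%:MP).
  by apply: sub_max; rewrite // /maxI mcoeffB mcoeffC eqxx mulr1 subrr.
have IC : is_ideal (C 1%N) by [].
have := idealZ (p@_0%MM)^-1 IC (idealB IC Cp Cq).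
by rewrite subKr -mul_mpolyC -mpolyCM mulVf.
Qed.

(** A maximal monomial of G is nonzero modulo I but is killed by every polynomial without constant
    term, so no such polynomial is regular. *)
Lemma depth_order_ideal : depth I 0.
Proof.
have [m [mG m_max]] := exists_maximal_monomial.
have [_ I1] := standard_graded_order_ideal.
split=> [|[//|f r] [f0 [_ /(_ 0%N isT)]]].
  by exists [::]; split=> //; split=> //; split=> // /(adjoin_nil _ II).
move/(_ 'X_[m]); rewrite take0 => freg; suff: I 'X_[m].
  by move/(_ m mG)/eqP; rewrite mcoeffX eqxx oner_eq0.
apply/(adjoin_nil _ II)/freg/(adjoin_nil _ II) => m' m'G.
have [m_le|m_nle] := boolP (m <= m')%MM.
  by rewrite (m_max m' m'G m_le) -[m in _@_m]addm0 mcoeffMX f0 ?mem_head.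
rewrite mcoeffMr big1 // => x /eqP mE; rewrite mcoeffX.
case: eqP => [xm|]; last by rewrite ?mulr0 ?mul0r.
by case/negP: m_nle; rewrite [X in (_ <= X)%MM]mE -xm lem_addr.
Qed.

(** The algebra is its own Artinian reduction, over k itself. If m times x_i lies in G, its
    coefficient in x_i p is that of m in p, so a socle element p has nonzero coefficients in G only
    at maximal monomials, which share one degree. *)
Lemma level_order_ideal : pure G -> level_algebra I.
Proof.
move=> Gpure; split; first exact: standard_graded_order_ideal.
  by exists 0%N; split; [apply: krull_dim_order_ideal|apply: depth_order_ideal].
exists k, idfun, [::]; have IK := proj1 (homogeneous_base_change idfun Ih).
have adjE p : adjoin (base_change idfun I) [::] p <-> I p.
  by split=> [/(adjoin_nil _ IK)/(base_change_id _ II)|/(base_change_id _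
    II)/(adjoin_nil _ IK)].
split=> //; first exact: krull_dim_order_ideal.
  by split=> // /adjE; have [] := standard_graded_order_ideal.
have [m0 m0_max] := exists_maximal_monomial; exists (mdeg m0) => p socp.
exists (pihomog mdeg (mdeg m0) p); first exact: pihomogP.
apply/adjE => m mG; rewrite mcoeffB mcoeff_pihomog.
case: eqP => [|mE]; rewrite ?subrr // subr0.
have [/existsP[i miG]|/existsPn nG] := boolP [exists i, (m + U_(i))%MM \in G].
  by have /adjE/(_ _ miG) := socp i; rewrite mulrC addmC mcoeffMX.
case: mE; apply: Gpure m0_max; split=> // m' m'G m_le.
have [//|/eqP/mnmP m'm] := eqVneq m' m.
have /existsP[i mi] : [exists i, (m i < m' i)%N].
  apply: contra_notT m'm => /existsPn lt i; apply/eqP.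
  by rewrite eqn_leq leqNgt lt (mnm_lepP m_le).
have /negP[] := nG i; apply: Gdiv m'G _; apply/mnm_lepP => j.
by rewrite mnmDE mnm1E; case: eqP => [<-|_];
  rewrite ?addn1 ?addn0 ?(mnm_lepP m_le).
Qed.

End ArtinianMonomialAlgebra.

Lemma pure_O_sequence_level (k : fieldType) (h : seq nat) :
  nth 0%N h 0 = 1%N -> pure_O_sequence h ->
  exists (n : nat) (I : {mpoly k[n]} -> Prop), level_algebra I /\ h_vector I h.
Proof.
move=> h0 [n [G [Gdiv Gpure hE]]]; have G0 : 0%MM \in G.
  have : #|` [fset m in G | mdeg m == 0]%fset | != 0%N by rewrite -hE h0.
  rewrite cardfs_eq0 => /fset0Pn[m]; rewrite !inE /= => /andP[mG /eqP m0].
  by move/eqP: m0; rewrite mdeg_eq0 => /eqP <-.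
exists n, (monomial_ideal (mem G)); split; first exact: level_order_ideal.
exists 0%N, (nth 0%N h); split=> [|i|m]; first exact: krull_dim_order_ideal.
  rewrite hE; apply: dim_component_monomial_ideal; first exact: fset_uniq.
  by move=> m; rewrite !inE.
rewrite expr0 big_ord_recl coef1 mul1r subn0 big1 ?addr0 // => j _.
by rewrite coef1 mul0r.
Qed.

(** * Concave sequences, partitions and staircases *)

(** The predicate holds on an initial segment, so cutting the count at t amounts to cutting the
    interval at t. *)
Lemma count_antitone (q : pred nat) t N : (forall u, q u.+1 -> q u) ->
  (t <= N)%N -> minn (count q (iota 0 N)) t = count q (iota 0 t).
Proof.
move=> q_anti tN; have q_le u v : (u <= v)%N -> q v -> q u.
  move/subnKC <-; elim: (v - u)%N => [|d IHd]; first by rewrite addn0.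
  by rewrite addnS => /q_anti.
have := count_size q (iota 0 t); rewrite size_iota => cnt_t.
rewrite -(subnKC tN) iotaD count_cat add0n.
have [|/allPn[u]] := boolP (all q (iota 0 t)).
  by rewrite all_count size_iota => /eqP ->; lia.
rewrite mem_iota add0n => /andP[_ ut] nqu.
rewrite (_ : count q (iota t _) = 0%N) ?addn0; first lia.
apply/eqP; rewrite -leqn0 leqNgt -has_count; apply/hasPn => v.
by rewrite mem_iota => /andP[tv _]; apply: contra nqu; apply: q_le; lia.
Qed.

(** [a] is the conjugate of the partition with parts l 0, .., l (N - 1): for each j < l 0 it has the
    number of u < N with j < l u as an entry. Both sums count the cells (u, j) with u < t and j < l
    u. *)
Lemma conjugate_partition (l : nat -> nat) N : (forall u, (l u.+1 <= l u)%N) ->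
  exists2 a : seq nat, all (fun x => 0 < x <= N)%N a &
    forall t, (t <= N)%N -> (\sum_(x <- a) minn x t = \sum_(u < t) l u)%N.
Proof.
move=> l_anti; have l_le u : (l u <= l 0)%N.
  by elim: u => // u; apply: leq_trans.
case: (posnP N) => [->|N0].
  exists [::] => // t; rewrite leqn0 => /eqP ->.
  by rewrite big_nil big_ord0.
exists [seq count (fun u => j < l u)%N (iota 0 N) | j <- iota 0 (l 0)].
  apply/allP => x /mapP[j]; rewrite mem_iota => /= jl ->; apply/andP; split.
    rewrite -has_count; apply/hasP; exists 0%N => //.
    by rewrite mem_iota.
  by rewrite -[X in (_ <= X)%N](size_iota 0) count_size.
move=> t tN; rewrite big_map.
have cnt j : minn (count (fun u => j < l u)%N (iota 0 N)) t =
    count (fun u => j < l u)%N (iota 0 t).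
  by apply: count_antitone => // u /leq_trans; apply.
under eq_bigr do rewrite cnt.
under eq_bigr => j _ do rewrite -sum1_count big_mkcond.
rewrite exchange_big (_ : iota 0 t = index_iota 0 t) ?big_mkord; last first.
  by rewrite /index_iota subn0.
apply: eq_bigr => u _; rewrite -big_mkcond sum1_count /=.
rewrite -(subnKC (l_le u)) iotaD count_cat add0n.
rewrite (eq_in_count (a2 := predT)) ?count_predT ?size_iota; last first.
  by move=> j; rewrite mem_iota.
rewrite (eq_in_count (a2 := pred0)) ?count_pred0 ?addn0 //.
by move=> j; rewrite mem_iota => /andP[lj _] /=; lia.
Qed.

Section StaircaseFunction.
Implicit Types (a : seq nat) (v : nat).

(* For a partition of the integers into consecutive blocks of sizes a, the last
   element of the block of v (junk value v beyond the last block). *)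
Fixpoint block_end a v : nat :=
  if a is x :: a' then (if v < x then x.-1 else x + block_end a' (v - x))%N
  else v.

Lemma leq_block_end a v : (v <= block_end a v)%N.
Proof. by elim: a v => //= x a IHa v; case: ltnP => xv; have := IHa (v - x)%N;
  lia. Qed.

Lemma block_end_mono a v v' : (v <= v')%N -> (block_end a v <= block_end a
  v')%N.
Proof.
elim: a v v' => //= x a IHa v v' vv'; case: ltnP => xv; case: ltnP => xv';
  try lia.
by rewrite leq_add2l IHa // leq_sub2r.
Qed.

Lemma block_endK a v : block_end a (block_end a v) = block_end a v.
Proof.
elim: a v => //= x a IHa v; case: (ltnP v x) => xv.
  by rewrite prednK ?leqnn //; apply: leq_ltn_trans xv.
by rewrite ltnNge leq_addr /= addKn IHa.
Qed.

Lemma block_end_lt a v : (v < sumn a)%N -> (block_end a v < sumn a)%N.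
Proof.
elim: a v => //= x a IHa v; case: (ltnP v x) => xv v_lt; first lia.
by rewrite ltn_add2l IHa // ltn_subLR.
Qed.

(** In a block of size x the distances to the end are 0, .., x - 1, each once, so min(x, g + 1) of
    them are at most g. *)
Lemma count_block_end a g :
  count (fun v => block_end a v - v <= g)%N (iota 0 (sumn a)) =
  (\sum_(x <- a) minn x g.+1)%N.
Proof.
elim: a => [|x a IHa] /=; first by rewrite big_nil.
rewrite big_cons iotaD count_cat; congr (_ + _)%N; last first.
  rewrite -IHa [(0 + x)%N]addnC iotaDl count_map; apply: eq_count => v /=.
  by rewrite ltnNge leq_addr /= addKn subnDl.
rewrite (eq_in_count (a2 := fun v => x - g.+1 <= v)%N); last first.
  by move=> v; rewrite mem_iota => /= vx; rewrite vx; lia.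
have [gx|gx] := leqP g.+1 x.
  rewrite (_ : iota 0 x = iota 0 (x - g.+1) ++ iota (x - g.+1) g.+1);
    last first.
    by rewrite -[X in iota X g.+1]add0n -iotaD subnK.
  rewrite count_cat (eq_in_count (a2 := pred0)) ?count_pred0; last first.
    by move=> v; rewrite mem_iota /= => vx; lia.
  rewrite (eq_in_count (a2 := predT)) ?count_predT ?size_iota //.
  by move=> v; rewrite mem_iota /= => vx; lia.
rewrite (eq_in_count (a2 := predT)) ?count_predT ?size_iota //.
by move=> v; rewrite mem_iota /= => vx; lia.
Qed.

End StaircaseFunction.

(** Concavity makes [l] antitone, and [h_lip] keeps its subtraction from truncating. The partial
    sums of [l] telescope to t + h (s + 1 - t), and [a] is the conjugate partition. *)
Lemma concave_partition s (h : nat -> nat) :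
  (0 < s)%N -> h 0%N = 1%N -> h 1%N = 2%N -> h s.+1 = 0%N ->
  (forall i, (i < s)%N -> (h i + h i.+2 <= h i.+1 + h i.+1)%N) ->
  exists2 a : seq nat, all (fun x => 0 < x <= s)%N a & sumn a = s.+2 /\
    forall t, (t <= s.+1)%N -> (\sum_(x <- a) minn x t = t + h (s.+1 - t))%N.
Proof.
move=> s0 h0 h1 hs hc; have h_lip i : (i <= s)%N -> (h i.+1 <= (h i).+1)%N.
  by elim: i => [|i IHi] i_s; [rewrite h0 h1|have := IHi (ltnW i_s);
    have := hc i i_s; lia].
pose l u := ((h (s - u)).+1 - h (s - u).+1)%N.
have [u|a a_le aE] := @conjugate_partition l s.
  rewrite /l; have [us|us] := ltnP u s.
    have := hc (s - u.+1)%N; have := h_lip (s - u.+1)%N.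
    by rewrite subnSK // => ? ?; lia.
  by rewrite (eqP (_ : s - u.+1 == 0)%N) ?h0 ?h1 // subn_eq0 leqW.
have sumE t : (t <= s)%N -> (\sum_(x <- a) minn x t = t + h (s.+1 - t))%N.
  move=> ts; rewrite aE //; elim: t ts => [|t IHt] ts.
    by rewrite big_ord0 subn0 hs.
  rewrite big_ord_recr /= IHt ?(ltnW ts) // /l subSS.
  by rewrite subSn ?(ltnW ts) //; have := h_lip (s - t)%N; lia.
(* No part exceeds s, so beyond t = s the sum keeps its value s + h 1 = s + 2. *)
have sumS t : (s <= t)%N -> (\sum_(x <- a) minn x t = s.+2)%N.
  move=> st; rewrite -[s.+2]addn2 -h1 -(subSnn s) -sumE //.
  rewrite big_seq [RHS]big_seq; apply: eq_bigr => x /(allP a_le)/andP[_ xs].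
  by rewrite !(minn_idPl _) // (leq_trans xs).
exists a => //; split=> [|t].
  rewrite -(sumS s.+2) ?leqW // sumnE big_seq [RHS]big_seq.
  apply: eq_bigr => x /(allP a_le)/andP[_ xs].
  by rewrite (minn_idPl _) // !leqW.
rewrite leq_eqVlt ltnS => /predU1P[->|]; last exact: sumE.
by rewrite sumS // subnn h0 addn1.
Qed.

Section Staircase.
Variables (s : nat) (a : seq nat).

Definition mnm2 (v w : nat) : 'X_{1..2} :=
  [multinom (if j == ord0 then v else w) | j < 2].

Lemma mnm2E (m : 'X_{1..2}) : m = mnm2 (m ord0) (m ord_max).
Proof. by apply/mnmP => -[[|[]]] // i; rewrite mnmE; congr (m _);
  apply/val_inj. Qed.

Lemma mdeg_mnm2 v w : mdeg (mnm2 v w) = (v + w)%N.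
Proof. by rewrite mdegE big_ord_recl big_ord1 !mnmE. Qed.

Lemma mnm2_inj v w v' w' : mnm2 v w = mnm2 v' w' -> v = v' /\ w = w'.
Proof.
move=> /mnmP eq_vw; have := eq_vw ord0; have := eq_vw ord_max.
by rewrite !mnmE.
Qed.

Lemma mnm2_le v w v' w' :
  (mnm2 v w <= mnm2 v' w')%MM = (v <= v')%N && (w <= w')%N.
Proof.
apply/mnm_lepP/andP => [le|[vv ww] j]; last by rewrite !mnmE; case: ifP.
by have := le ord0; have := le ord_max; rewrite !mnmE.
Qed.

(** The list of pairs only supplies a finite range: the condition bounds both exponents by s,
    because [v <= block_end a v]. *)
Definition staircase : {fset 'X_{1..2}} :=
  [fset m in [seq mnm2 v w | v <- iota 0 s.+1, w <- iota 0 s.+1]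
     | (m ord_max + block_end a (m ord0) <= s)%N]%fset.

Lemma mem_staircase v w :
  (mnm2 v w \in staircase) = (w + block_end a v <= s)%N.
Proof.
have : (w + block_end a v <= s)%N ->
    mnm2 v w \in [seq mnm2 v w | v <- iota 0 s.+1, w <- iota 0 s.+1].
  move=> vw; have ve := leq_block_end a v.
  by apply/allpairsP; exists (v, w); rewrite !mem_iota; split=> //=; lia.
rewrite /staircase; move: [seq _ | _ <- _, _ <- _] => r rP.
by rewrite !inE /= !mnmE /= andb_idl.
Qed.

Lemma order_ideal_staircase : order_ideal staircase.
Proof.
move=> m1 m2; rewrite [m1]mnm2E [m2]mnm2E !mem_staircase mnm2_le => le_s.
by case/andP=> /(block_end_mono a) ? ?; lia.
Qed.

(* Every (v, w) in the staircase divides (e, s - e) with e := block_end a v. *)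
Lemma pure_staircase : pure staircase.
Proof.
suff max_s m : maximal_monomial staircase m -> mdeg m = s.
  by move=> m1 m2 /max_s -> /max_s ->.
rewrite [m]mnm2E; set v := m ord0; set w := m ord_max.
rewrite /maximal_monomial mem_staircase => -[vw m_max].
have ve := leq_block_end a v.
have <- := m_max (mnm2 (block_end a v) (s - block_end a v)).
- by rewrite mdeg_mnm2; lia.
- by rewrite mem_staircase block_endK; lia.
- by rewrite mnm2_le; lia.
Qed.

Hypotheses (sum_a : sumn a = s.+2).

(** The monomial with exponents (v, i - v) is in the staircase when the distance from v to its block
    end is at most s - i. Each v from i + 1 to s + 1 satisfies this bound too, as block ends stay
    below s + 2; these values give the extra s - i + 1. *)
Lemma card_staircase i : (i <= s)%N ->
  (#|` [fset m in staircase | mdeg m == i]%fset | + (s - i).+1 =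
   \sum_(x <- a) minn x (s - i).+1)%N.
Proof.
move=> i_s; rewrite -count_block_end sum_a.
move: staircase mem_staircase => G memG.
pose q v := (block_end a v - v <= s - i)%N.
have -> : #|` [fset m in G | mdeg m == i]%fset | = count q (iota 0 i.+1).
  rewrite -size_filter -(size_map (fun v => mnm2 v (i - v))).
  apply/perm_size/uniq_perm; first exact: fset_uniq.
    rewrite map_inj_uniq ?filter_uniq ?iota_uniq // => v v' /mnm2_inj[] //.
  move=> m; rewrite !inE [m]mnm2E; set v := m ord0; set w := m ord_max.
  rewrite memG mdeg_mnm2; apply/andP/mapP.
    case=> vw /eqP vwi; exists v; last by congr mnm2; lia.
    by rewrite mem_filter mem_iota /q; have := leq_block_end a v; lia.
  case=> v'; rewrite mem_filter mem_iota /q => /andP[qv' /andP[_ v'i]].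
  move/mnm2_inj=> [-> ->]; have := leq_block_end a v'.
  by split; lia.
have -> : s.+2 = (i.+1 + (s - i).+1)%N by lia.
rewrite iotaD count_cat; congr (_ + _)%N; rewrite -[LHS](size_iota i.+1).
apply/esym/eqP; rewrite -all_count; apply/allP => v;
  rewrite mem_iota => /andP[iv vs].
have := @block_end_lt a v; rewrite sum_a.
have := leq_block_end a v; lia.
Qed.

End Staircase.

Lemma concave_pure_O_sequence (s : nat) (h : seq nat) :
  (0 < s)%N -> size h = s.+1 -> nth 0%N h 0 = 1%N -> nth 0%N h 1 = 2%N ->
  (forall i, (i < s)%N ->
    (nth 0%N h i + nth 0%N h i.+2 <= nth 0%N h i.+1 + nth 0%N h i.+1)%N) ->
  pure_O_sequence h.
Proof.
move=> s0 size_h h0 h1 hc;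
  have hs : nth 0%N h s.+1 = 0%N by rewrite nth_default ?size_h.
have [a a_pos [sum_a aE]] := concave_partition s0 h0 h1 hs hc.
exists 2, (staircase s a); split=> [||i].
- exact: order_ideal_staircase.
- exact: pure_staircase.
have [i_s|s_i] := leqP i s.
  have := card_staircase sum_a i_s;
    rewrite aE ?ltnS ?leq_subr // subSS subKn //.
  by rewrite addnC => /addnI.
rewrite nth_default ?size_h //; apply/esym/eqP; rewrite cardfs_eq0.
move: (staircase s a) (mem_staircase s a) => G memG.
apply/eqP/fsetP => m; rewrite !inE [m]mnm2E.
move: (m ord0) (m ord_max) => v w; rewrite memG mdeg_mnm2.
apply/negbTE/negP => /andP[vw /eqP vwi].
by have := leq_block_end a v; lia.
Qed.

(** * Krull dimension of Stanley-Reisner rings *)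

Section ChainIndependence.
Variables (k : fieldType) (n : nat) (e : nat).
Variables (C : nat -> {mpoly k[n]} -> Prop) (x : nat -> {mpoly k[n]}).
Hypotheses (C_prime : forall i, (i <= e)%N -> prime_ideal (C i))
  (C_sub : forall i, (i < e)%N -> forall p, C i p -> C i.+1 p)
  (x_in : forall i, (i < e)%N -> C i.+1 (x i))
  (x_out : forall i, (i < e)%N -> ~ C i (x i)).

(* In a relation between x j, .., x (e - 1) modulo C j, one may cancel the
   lowest power of x j and then reduce modulo C j.+1, which contains x j. *)
Lemma chain_independent (T : finType) (E : T -> nat -> nat) (c : T -> k) j :
  (j <= e)%N ->
  (forall t t', c t != 0 -> c t' != 0 ->
     (forall l, (j <= l < e)%N -> E t l = E t' l) -> t = t') ->
  (exists t, c t != 0) ->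
  ~ C j (\sum_t c t *: \prod_(j <= l < e) x l ^+ E t l).
Proof.
(* Descending induction on j, run on d = e - j. *)
move=> je; rewrite -(subKn je); move: (leq_subr j e);
  move: (e - j)%N => {j je}d.
elim: d c => [|d IHd] c de c_inj [t0 ct0].
  (* For j = e the products are empty and the condition on exponents is vacuous, so just one
     coefficient is nonzero and a unit would lie in a prime. *)
  rewrite subn0 => Ce; have [Ie C1 _] := C_prime (leqnn e); apply: C1.
  move: Ce; rewrite (bigD1 t0) //= [X in _ + X]big1 ?addr0 => [|t tt0].
    rewrite big_geq // => /(idealZ (c t0)^-1 Ie).
    by rewrite scalerA mulVf ?scale1r.
  have [->|ct] := eqVneq (c t) 0; first by rewrite scale0r.
  case/eqP: tt0; apply: (c_inj) => // l; lia.
set j := (e - d.+1)%N; have jS : (e - d)%N = j.+1 by rewrite /j; lia.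
have je : (j < e)%N by rewrite /j; lia.
have [Ij Cj1 Cj_pr] := C_prime (ltnW je).
have [IjS _ _] := C_prime je.
case: (arg_minnP (fun t => E t j) (P := fun t => c t != 0) ct0) =>
  t1 ct1 t1_min.
set a := E t1 j in t1_min.
pose y t := \prod_(j.+1 <= l < e) x l ^+ E t l.
have -> : \sum_t c t *: \prod_(j <= l < e) x l ^+ E t l =
    x j ^+ a * \sum_(t | c t != 0) c t *: (x j ^+ (E t j - a) * y t).
  rewrite [LHS](bigID (fun t => c t != 0)) /= addrC big1 ?add0r => [|t];
    last first.
    by move/negbNE/eqP => ->; rewrite scale0r.
  rewrite mulr_sumr; apply: eq_bigr => t ct; rewrite big_ltn // -scalerAr mulrA.
  by rewrite -exprD subnKC // t1_min.
have xa_out b : ~ C j (x j ^+ b).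
  by elim: b => [|b IHb]; rewrite ?expr0 // exprS => /Cj_pr[/x_out|]; auto.
case/Cj_pr => [/xa_out //|]; move/(C_sub je).
(* [c'] keeps the terms of lowest exponent in x j; the others remain multiples of x j after the
   cancellation and vanish modulo [C j.+1]. *)
pose c' t := if E t j == a then c t else 0.
rewrite (bigID (fun t => E t j == a)) /=.
set u := \sum_(t | _ && _) _; set v := \sum_(t | _ && _) _ => Cuv.
have Cv : C j.+1 v.
  apply: ideal_sum => // t _ /andP[ct Eta]; apply: idealZ => //.
  have -> : (E t j - a)%N = (E t j - a).-1.+1.
    by rewrite prednK // subn_gt0 ltn_neqAle eq_sym Eta t1_min.
  by rewrite exprS -mulrA mulrC; case: (IjS) => _ _ IM; apply/IM/x_in.
apply: (IHd c'); first exact: ltnW.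
- move=> t t'; rewrite /c' jS.
  case: (E t j =P a) => [Et|]; last by rewrite eqxx.
  case: (E t' j =P a) => [Et'|]; last by rewrite eqxx.
  move=> ct ct' Ett'; apply: c_inj => // l /andP[]; rewrite leq_eqVlt.
  by case/predU1P => [<- _|jl le]; [rewrite -/j Et Et' | rewrite Ett' // jl le].
- by exists t1; rewrite /c' eqxx.
have -> : \sum_t c' t *: \prod_(e - d <= l < e) x l ^+ E t l = u + v - v.
  rewrite addrK /u jS [LHS](bigID (fun t => c t != 0)) /=.
  rewrite [X in _ + X]big1 ?addr0 => [|t]; last first.
    by move/negbNE/eqP => ct; rewrite /c' ct if_same scale0r.
  rewrite [RHS]big_mkcondr; apply: eq_bigr => t ct; rewrite /c'.
  case: (E t j =P a) => [->|_]; last by rewrite scale0r.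
  by rewrite subnn expr0 mul1r.
by rewrite jS; apply: idealB.
Qed.

End ChainIndependence.

Definition supp (n : nat) (m : 'X_{1..n}) : {set 'I_n} := [set i | m i != 0%N].

Section FaceIdeals.
Variables (k : fieldType) (n : nat).
Implicit Types (D : {set {set 'I_n}}) (B F : {set 'I_n}) (p q : {mpoly k[n]}).

Definition face_ideal D : {mpoly k[n]} -> Prop :=
  monomial_ideal (fun m => supp m \in D).

Lemma suppS (m1 m2 : 'X_{1..n}) : (m1 <= m2)%MM -> supp m1 \subset supp m2.
Proof.
move=> /mnm_lepP le; apply/subsetP => i; rewrite !inE -!lt0n => m1i.
exact: leq_trans (le i).
Qed.

Lemma divisor_closed_face D :
  simplicial_complex D -> divisor_closed (fun m => supp m \in D).
Proof. by move=> [_ Dsub] m1 m2 m2D /suppS; apply: Dsub. Qed.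

Lemma simplicial_powerset B : simplicial_complex (powerset B).
Proof.
split=> [|F G]; rewrite !powersetE ?sub0set // => FB GF.
exact: subset_trans FB.
Qed.

(* S / face_ideal (powerset B) is the polynomial ring in the variables of B. *)
Lemma prime_face_ideal_powerset B : prime_ideal (face_ideal (powerset B)).
Proof.
have [II _] := homogeneous_monomial_ideal k
  (divisor_closed_face (simplicial_powerset B)).
(* The ideal is the kernel of the substitution [z], whose values lie in a domain. *)
pose z : n.-tuple {mpoly k[n]} := [tuple if i \in B then 'X_i else 0 | i < n].
have zX (m : 'X_{1..n}) : 'X_[m] \mPo z = if supp m \subset B then 'X_[m] else
  0.
  rewrite comp_mpolyX; case: ifP => [/subsetP mB|/subsetPn[i]].
    rewrite [RHS]mpolyXE_id; apply: eq_bigr => i _; rewrite tnth_mktuple.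
    have [->|mi] := eqVneq (m i) 0%N; first by rewrite !expr0.
    by rewrite mB ?inE.
  rewrite inE => mi iB; rewrite (bigD1 i) //= tnth_mktuple (negPf iB).
  by rewrite expr0n (negPf mi) mul0r.
have coef_z p m : (p \mPo z)@_m = if supp m \subset B then p@_m else 0.
  rewrite comp_mpolyEX [p in RHS]mpolyE !raddf_sum /=.
  case: ifP => mB; [apply: eq_bigr|apply: big1] => x _;
    rewrite !mcoeffZ zX; case: ifP => xB //;
      rewrite ?mcoeff0 ?mcoeffX ?mulr0 //;
    by case: eqP => [xm|_]; rewrite ?mulr0 //; rewrite -xm xB in mB.
have IE p : face_ideal (powerset B) p <-> p \mPo z = 0.
  split=> [Ip|p0 m].
    apply/mpolyP => m; rewrite coef_z mcoeff0; case: ifP => // mB.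
    by apply: Ip; rewrite powersetE.
  by rewrite powersetE => mB; have := coef_z p m; rewrite mB p0 mcoeff0.
split=> // [/IE/eqP|p q /IE/eqP]; first by rewrite rmorph1 oner_eq0.
by rewrite rmorphM mulf_eq0 => /orP[] /eqP ?; [left|right]; apply/IE.
Qed.

Lemma face_ideal_sub D B : B \in D -> simplicial_complex D ->
  forall p, face_ideal D p -> face_ideal (powerset B) p.
Proof.
move=> BD [_ Dsub] p Ip m; rewrite powersetE => mB; apply: Ip.
exact: Dsub mB.
Qed.

(** Removing the vertices of F one by one enlarges the prime; the variable of the removed vertex
    shows that each inclusion is strict. *)
Lemma prime_chain_face D F : simplicial_complex D -> F \in D ->
  exists C, prime_chain (face_ideal D) #|F| C.
Proof.
move=> Dsc FD; have [_ Dsub] := Dsc.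
pose B i : {set 'I_n} := [set x in drop i (enum F)].
have BF i : B i \subset F.
  by apply/subsetP => x; rewrite inE => /mem_drop; rewrite mem_enum.
exists (fun i => face_ideal (powerset (B i))); split=> i iF.
  split; first exact: prime_face_ideal_powerset.
  by apply: face_ideal_sub => //; apply: Dsub (BF i).
have iF' : (i < size (enum F))%N by rewrite -cardE.
have [x0 _] : exists x0, x0 \in F by apply/card_gt0P/(leq_ltn_trans _ iF).
set x := nth x0 (enum F) i.
have BE : B i = x |: B i.+1.
  by apply/setP => y; rewrite !inE (drop_nth x0 iF') inE.
have xB : x \notin B i.+1.
  have := drop_uniq i (enum_uniq (mem F)).
  by rewrite (drop_nth x0 iF') inE => /andP[].
split=> [p Ip m|].
  rewrite powersetE => mB; apply: Ip; rewrite powersetE BE.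
  exact: subset_trans mB (subsetU1 _ _).
have suppx : supp U_(x)%MM = [set x].
  by apply/setP => y; rewrite !inE mnm1E eqb0 negbK eq_sym.
exists 'X_x; split=> [m|/(_ U_(x)%MM)].
  rewrite powersetE mcoeffX; case: eqP => // <-; rewrite suppx sub1set.
  by rewrite (negPf xB).
rewrite powersetE suppx sub1set BE setU11 mcoeffX eqxx => /(_ isT)/eqP.
by rewrite oner_eq0.
Qed.

Lemma msize_prod_le (J : Type) (r : seq J) (P : pred J) (f : J -> {mpoly k[n]})
    (d : J -> nat) : (forall j, P j -> (msize (f j) <= (d j).+1)%N) ->
  (msize (\prod_(j <- r | P j) f j) <= (\sum_(j <- r | P j) d j).+1)%N.
Proof.
move=> fd; apply: (big_ind2 (fun (p : {mpoly k[n]}) d =>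
  msize p <= d.+1)%N) => //.
  by rewrite msize1.
move=> p a q b pa qb; have [->|p0] := eqVneq p 0; first by rewrite mul0r msize0.
have [->|q0] := eqVneq q 0; first by rewrite mulr0 msize0.
rewrite msizeM // -subn1 leq_subLR; apply: leq_trans (leq_add pa qb) _.
by rewrite addSn addnS.
Qed.

Lemma msize_exp_le (p : {mpoly k[n]}) (d m : nat) :
  (msize p <= d.+1)%N -> (msize (p ^+ m) <= (d * m).+1)%N.
Proof.
move=> pd; rewrite -[m in p ^+ m]subn0 -prodr_const_nat.
apply: leq_trans (msize_prod_le _ (d := fun=> d) _) _ => //.
by rewrite sum_nat_const_nat subn0 mulnC.
Qed.

Lemma card_face_exponents D r L :
  (forall F, F \in D -> (#|F| <= r)%N) ->
  (#|[set u : {ffun 'I_n -> 'I_L.+1} | [set i | u i != ord0] \in D]| <=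
     #|D| * L.+1 ^ r)%N.
Proof.
move=> Dr; pose U F := [set u : {ffun 'I_n -> 'I_L.+1} | [set i | u i != ord0]
  == F].
rewrite (_ : [set u | _] = \bigcup_(F in D) U F); last first.
  apply/setP => u; rewrite inE; apply/idP/bigcupP => [uD|[F FD]].
    by exists [set i | u i != ord0]; rewrite // inE.
  by rewrite inE => /eqP ->.
apply: leq_trans (_ : \sum_(F in D) L.+1 ^ r <= _)%N;
  last by rewrite sum_nat_const.
elim/big_ind2: _ => [|A a B b Aa Bb|F FD]; first by rewrite cards0.
  by apply: leq_trans (leq_card_setU _ _) _; apply: leq_add.
apply: leq_trans (leq_pexp2l _ (Dr F FD)) => //.
have -> : (L.+1 ^ #|F|)%N = #|pffun_on (ord0 : 'I_L.+1) (mem F) (mem 'I_L.+1)|.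
  by rewrite card_pffun_on card_ord.
apply/subset_leq_card/subsetP => u; rewrite inE => /eqP uF.
apply/pffun_onP; split; last by move=> i _; rewrite inE.
by apply/subsetP => i ui; have : i \in F by rewrite -uF inE.
Qed.

(* Pigeonhole: modulo the ideal there are O(N ^ r) monomials of degree O(N), but
   N ^ e products of the x i with exponents below N. *)
Lemma face_ideal_dependence D r (e : nat) (x : 'I_e -> {mpoly k[n]}) :
  (r < e)%N -> (forall F, F \in D -> (#|F| <= r)%N) ->
  exists N (c : {ffun 'I_e -> 'I_N} -> k), (exists t, c t != 0) /\
    face_ideal D (\sum_t c t *: \prod_i x i ^+ t i).
Proof.
move=> re Dr; pose d := \max_i msize (x i).
(* With L = e d N one has L + 1 <= N (e d + 1), so |D| (L + 1)^r <= N^r |D| (e d + 1)^r < N^(r + 1)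
   <= N^e. *)
pose N := (#|D| * (e * d).+1 ^ r).+1; exists N.
pose L := (e * d * N)%N; pose T := {ffun 'I_e -> 'I_N}.
pose U := [set u : {ffun 'I_n -> 'I_L.+1} | [set i | u i != ord0] \in D].
pose y (t : T) := \prod_i x i ^+ t i.
pose mon (u : {ffun 'I_n -> 'I_L.+1}) : 'X_{1..n} := [multinom u i : nat | i <
  n].
have y_size t : (msize (y t) <= L.+1)%N.
  apply: leq_trans (msize_prod_le _ (d := fun=> (d * N)%N) _) _ => [i _|].
    apply: leq_trans (msize_exp_le (d := d) _ _) _.
      by apply: leqW; apply: leq_bigmax.
    by rewrite ltnS leq_mul2l ltnW ?orbT.
  by rewrite sum_nat_const card_ord mulnA.
have UT : (#|U| < #|T|)%N.
  apply: leq_ltn_trans (card_face_exponents L Dr) _.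
  rewrite card_ffun !card_ord.
  apply: (@leq_trans (N ^ r.+1)); last by rewrite leq_pexp2l.
  have LN : (L.+1 <= N * (e * d).+1)%N by rewrite mulnS [(N * (e * d))%N]mulnC
    -add1n leq_add2r.
  apply: (@leq_ltn_trans (#|D| * (N * (e * d).+1) ^ r)).
    by rewrite leq_mul2l; apply/orP; right; case: (r) => // r';
      rewrite leq_exp2r.
  by rewrite expnMn mulnCA expnSr ltn_mul2l expn_gt0 /= ltnS.
(* Rows are the products, columns the standard monomials; there are more rows than columns, and a
   vector in the left kernel gives the relation. *)
pose A := \matrix_(i < #|T|, j < #|U|) (y (enum_val i))@_(mon (enum_val j)).
have : kermx A != 0.
  rewrite kermx_eq0 /row_free neq_ltn.
  by rewrite (leq_ltn_trans (rank_leq_col A) UT).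
case/rowV0Pn => c /sub_kermxP cA c0.
exists (fun t => c 0 (enum_rank t)); split.
  have [j cj] : exists j, c 0 j != 0.
    apply/existsP; apply: contraNT c0 => /existsPn c0; apply/eqP/rowP => j.
    by rewrite mxE; apply/eqP/negPn/c0.
  by exists (enum_val j); rewrite enum_valK.
move=> m mD; rewrite raddf_sum /=.
have [mL|mL] := leqP (mdeg m) L; last first.
  rewrite big1 // => t _; rewrite mcoeffZ memN_msupp_eq0 ?mulr0 //.
  apply: contraL mL => /msize_mdeg_lt mt; rewrite -leqNgt -ltnS.
  exact: leq_trans mt (y_size t).
have m_le i : (m i < L.+1)%N.
  by rewrite ltnS (leq_trans _ mL) // mdegE (bigD1 i) //= leq_addr.
pose u : {ffun 'I_n -> 'I_L.+1} := [ffun i => Ordinal (m_le i)].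
have mE : mon u = m by apply/mnmP => i; rewrite mnmE ffunE.
have uU : u \in U.
  rewrite inE (_ : [set i | _] = supp m) //.
  by apply/setP => i; rewrite !inE ffunE.
have := congr1 (fun B : 'rV_#|U| => B 0 (enum_rank_in uU u)) cA.
rewrite !mxE => cA0; rewrite -[RHS]cA0.
rewrite (reindex (@enum_val _ (mem T))) /=; last first.
  by apply: onW_bij; apply: enum_val_bij.
apply: eq_bigr => i _; rewrite mcoeffZ enum_valK mxE enum_rankK_in // mE //.
Qed.

Lemma krull_dim_face_ideal D F : simplicial_complex D -> F \in D ->
  (forall G, G \in D -> (#|G| <= #|F|)%N) -> krull_dim (face_ideal D) #|F|.
Proof.
move=> Dsc FD F_max; split; first exact: prime_chain_face.
move=> e C [C_prime C_sub]; rewrite leqNgt; apply/negP => Fe.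
set r := #|F| in F_max Fe.
have /fin_all_exists2[x x_in x_out] (i : 'I_r.+1) :
    exists2 p, C i.+1 p & ~ C i p.
  have [_ [p [Cp nCp]]] := C_sub i (leq_trans (ltn_ord i) Fe).
  by exists p.
have [N [c [c0 Ic]]] := face_ideal_dependence x (ltnSn r) F_max.
pose x' l := x (inord l).
pose E (t : {ffun 'I_r.+1 -> 'I_N}) l : nat := t (inord l).
apply: (chain_independent (C := C) (x := x') (E := E) (c := c) _ _ _ _ (leq0n
  r.+1)).
- by move=> i i_r; have [] := C_prime i (leq_trans i_r Fe).
- by move=> i i_r; have [] := C_sub i (leq_trans i_r Fe).
- by move=> i i_r; have := x_in (inord i); rewrite inordK.
- by move=> i i_r; have := x_out (inord i); rewrite inordK.
- move=> t t' _ _ tt'; apply/ffunP => i; apply/val_inj.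
  by have := tt' i; rewrite /E inord_val /= ltn_ord; apply.
- by [].
have [_ CI] := C_prime 0%N isT; have := CI _ Ic.
congr C; apply: eq_bigr => t _; congr (_ *: _).
by rewrite big_mkord; apply: eq_bigr => i _; rewrite /x' /E inord_val.
Qed.
End FaceIdeals.

(** * Matroid duality *)

Section Extensionality.
Variables (k : fieldType) (n : nat) (I J : {mpoly k[n]} -> Prop).
Hypothesis IJ : forall p, I p <-> J p.

Lemma krull_dim_ext d : krull_dim I d -> krull_dim J d.
Proof.
have sub (C : {mpoly k[n]} -> Prop) : (forall p, I p -> C p) <-> (forall p, J p
  -> C p).
  by split=> H p /IJ /H.
have chain e C : prime_chain I e C <-> prime_chain J e C.
  by split=> -[HC CS]; split=> // i ie; have [HP HI] := HC i ie; split=> //;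
    apply/sub.
case=> [[C /chain HC] le_d]; split; first by exists C.
by move=> e C' /chain; apply: le_d.
Qed.

Lemma dim_component_ext i m : dim_component I i m -> dim_component J i m.
Proof.
case=> b [bi bgen bfree]; exists b; split=> // [p /bgen[c /IJ Ic]|c /IJ].
  by exists c.
exact: bfree.
Qed.

Lemma h_vector_ext h : h_vector I h -> h_vector J h.
Proof.
case=> d [HF [dimI HFP hE]]; exists d, HF; split=> // [|i].
  exact: krull_dim_ext.
exact: dim_component_ext.
Qed.

End Extensionality.

Section DualMatroid.
Variable n : nat.
Implicit Types (D : {set {set 'I_n}}) (A B F G : {set 'I_n}).

Definition dual D : {set {set 'I_n}} :=
  [set F : {set 'I_n} | [exists B, facet D B && [disjoint F & B]]].

Lemma mem_dual D (F : {set 'I_n}) :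
  reflect (exists2 B, facet D B & [disjoint F & B]) (F \in dual D).
Proof.
rewrite inE; apply: (iffP existsP) => [[B /andP[]]|[B]]; first by exists B.
by move=> BD FB; exists B; rewrite BD.
Qed.

Lemma facet_mem D B : facet D B -> B \in D.
Proof. by case/maxsetP. Qed.

Lemma sub_facet D F : F \in D -> exists2 B, facet D B & F \subset B.
Proof. by move=> FD; have [B] := maxset_exists (P := fun G => G \in D) FD;
  exists B. Qed.

Lemma simplicial_complex_dual D : simplicial_complex D -> simplicial_complex
  (dual D).
Proof.
case=> D0 _; split=> [|F G /mem_dual[B BD FB] GF].
  have [B BD _] := sub_facet D0; apply/mem_dual; exists B => //.
  by rewrite -setI_eq0 set0I.
by apply/mem_dual; exists B => //; apply: disjointWl FB.
Qed.

Section Matroid.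
Variable D : {set {set 'I_n}}.
Hypothesis Dm : matroid D.

Lemma leq_card_facet B F : facet D B -> F \in D -> (#|F| <= #|B|)%N.
Proof.
move=> /maxsetP[BD B_max] FD; rewrite leqNgt; apply/negP => BF.
have [_ exch] := Dm; have [i] := exch B F BD FD BF.
rewrite inE => /andP[iB _] iBD; case/negP: iB.
by rewrite -(B_max _ iBD) ?setU11 // subsetU1.
Qed.

Lemma card_facet B B' : facet D B -> facet D B' -> #|B| = #|B'|.
Proof.
move=> BD B'D; apply/eqP.
by rewrite eqn_leq !leq_card_facet // facet_mem.
Qed.

Lemma facet_card B F : facet D B -> F \in D -> (#|B| <= #|F|)%N -> facet D F.
Proof.
move=> BD FD BF; have [G GD FG] := sub_facet FD.
suff /eqP -> : F == G by [].
by rewrite eqEcard FG -(card_facet BD GD).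
Qed.

(** A maximal independent set between A and A :|: B has the size of B, since otherwise exchange with
    B would enlarge it. *)
Lemma augment A B : A \in D -> facet D B ->
  exists2 G, facet D G & (A \subset G) && (G \subset A :|: B).
Proof.
move=> AD BD; have [_ exch] := Dm.
have [G /maxsetP[/andP[GD GAB] G_max] AG] :=
  maxset_exists (P := fun G => (G \in D) && (G \subset A :|: B)) (C := A)
    (introT andP (conj AD (subsetUl A B))).
exists G; last by rewrite AG.
apply: (facet_card BD GD); rewrite leqNgt; apply/negP => GB.
have [i] := exch G B GD (facet_mem BD) GB.
rewrite inE => /andP[iG iB] iGD; case/negP: iG.
rewrite -(G_max (i |: G)) ?setU11 ?subsetU1 // iGD subUset GAB andbT.
by rewrite sub1set inE iB orbT.
Qed.

(* Augmenting B' :\: F from B gives a facet B2 disjoint from F. It misses some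
   element of G :\: F, having room for only #|B' :&: F| <= #|F :\: G| elements
   outside of B' :\: F. *)
Lemma matroid_dual : matroid (dual D).
Proof.
split=> [|F G /mem_dual[B BD FB] /mem_dual[B' BD' GB] FG].
  by apply: simplicial_complex_dual; case: Dm.
have [[_ Dsub] _] := Dm.
have BFD : B' :\: F \in D by apply: Dsub (facet_mem BD') (subsetDl _ _).
have [B2 B2D /andP[B'B2 B2B]] := augment BFD BD.
have B2F : [disjoint F & B2].
  apply: disjointWr B2B _; rewrite -setI_eq0 setIUr setU_eq0 !setI_eq0.
  by rewrite FB andbT -setI_eq0; apply/eqP/setP => x; rewrite !inE;
    case: (x \in F).
have [GF|/subsetPn[i iGF iB2]] := boolP (G :\: F \subset B2); last first.
  exists i => //; apply/mem_dual; exists B2 => //.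
  by rewrite -setI_eq0 setIUl setU_eq0 !setI_eq0 B2F disjoints1 iB2.
have : (#|(B' :\: F) :|: (G :\: F)| <= #|B2|)%N by rewrite subset_leq_card //
  subUset B'B2.
rewrite (card_facet B2D BD') cardsU disjoint_setI0 ?cards0 ?subn0; last first.
  by rewrite disjoint_sym; apply: disjointW GB; rewrite subsetDl.
have := cardsID F B'; have := cardsID F G.
have : (#|B' :&: F| <= #|F :\: G|)%N.
  apply/subset_leq_card/subsetP => x; rewrite !inE => /andP[xB' ->].
  by rewrite andbT; apply: contraL xB' => xG; rewrite (disjointFr GB).
have := cardsID G F; rewrite [G :&: F]setIC; lia.
Qed.

Lemma facet_dual B : facet D B -> facet (dual D) (~: B).
Proof.
move=> BD; apply/maxsetP; split.
  by apply/mem_dual; exists B; rewrite // disjoints_subset.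
move=> G /mem_dual[B' BD' GB'] BG.
have B'B : B' = B.
  apply/eqP; rewrite eqEcard (card_facet BD BD') leqnn andbT.
  by rewrite -setCS (subset_trans BG) // -disjoints_subset.
by apply/eqP; rewrite eqEsubset BG andbT -disjoints_subset -B'B.
Qed.

Lemma facet_dualP F : facet (dual D) F -> facet D (~: F).
Proof.
move=> /maxsetP[/mem_dual[B BD FB] F_max].
suff <- : B = ~: F by [].
rewrite -[B]setCK; congr (~: _); apply: F_max;
  last by rewrite -disjoints_subset.
exact/facet_mem/facet_dual.
Qed.

Lemma dualK : dual (dual D) = D.
Proof.
apply/setP => F; apply/mem_dual/idP => [[B /facet_dualP BD FB]|FD].
  have [[_ Dsub] _] := Dm; apply: Dsub (facet_mem BD) _.
  by rewrite -disjoints_subset.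
have [B BD FB] := sub_facet FD; exists (~: B); first exact: facet_dual.
by rewrite disjoints_subset setCK.
Qed.

End Matroid.

(** * Stanley-Reisner ideals and cover ideals as monomial ideals *)

Variable k : fieldType.

Lemma stanley_reisner_face_ideal D p : simplicial_complex D ->
  stanley_reisner_ideal (k := k) D p <-> face_ideal D p.
Proof.
move=> Dsc.
have [II _] := homogeneous_monomial_ideal k (divisor_closed_face Dsc).
have prodX F : \prod_(i in F) 'X_i = 'X_[mesym1 F] :> {mpoly k[n]}.
  rewrite mpolyXE_id big_mkcond; apply: eq_bigr => i _; rewrite mnmE.
  by case: (i \in F).
have suppF F : supp (mesym1 F) = F.
  by apply/setP => i; rewrite inE mnmE; case: (i \in F).
split=> [|Ip].
  apply: (ideal_gen_min II) => _ [F FD ->] m mD; rewrite prodX mcoeffX.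
  by case: eqP => // mE; rewrite -mE suppF (negPf FD) in mD.
rewrite (mpolyE p); apply: ideal_sum; first exact: ideal_genP.
move=> m mp _; apply: idealZ; first exact: ideal_genP.
have mF : (mesym1 (supp m) <= m)%MM.
  by apply/mnm_lepP => i; rewrite mnmE inE; case: (m i).
rewrite -(submK mF) mpolyXD.
have [_ _ IM] := ideal_genP
  (fun q : {mpoly k[n]} => exists2 F, F \notin D & q = \prod_(i in F) 'X_i).
apply/IM/mem_ideal_gen; exists (supp m); last by rewrite prodX.
by apply: contraTN mp => mD; rewrite mcoeff_msupp Ip ?eqxx.
Qed.

(** A polynomial lies in (x_i : i in B) exactly when the supports of its monomials all meet B. So
    the monomials outside the intersection are those whose support misses some facet. *)
Lemma cover_face_ideal D p :
  cover_ideal (k := k) D p <-> face_ideal (dual D) p.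
Proof.
split=> [Jp m /mem_dual[B BD mB]|Ip B BD].
  have [cs [Gcs ->]] := Jp B BD;
    rewrite raddf_sum big_seq big1 // => -[a q] /Gcs[i iB /= ->].
  rewrite mulrC; apply/eqP; rewrite mcoeff_eq0; apply/negP.
  rewrite mulrC (perm_mem (msuppMX _ _)) => /mapP[m' _ mE].
  have := disjointFl mB iB; rewrite inE mE mnmDE mnm1E eqxx.
  by [].
rewrite (mpolyE p); apply: ideal_sum; first exact: ideal_genP.
move=> m mp _; apply: idealZ; first exact: ideal_genP.
have [mB|] := boolP [disjoint supp m & B].
  move: mp; rewrite mcoeff_msupp Ip ?eqxx //.
  by apply/mem_dual; exists B.
case/pred0Pn => i /andP[/=]; rewrite inE => mi iB.
rewrite -(@submK _ U_(i)%MM m) ?lep1mP // mpolyXD.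
have [_ _ IM] := ideal_genP (fun q : {mpoly k[n]} =>
  exists2 i, i \in B & q = 'X_i).
by apply/IM/mem_ideal_gen; exists i.
Qed.

Lemma krull_dim_dual D B : matroid D -> facet D B ->
  krull_dim (face_ideal (k := k) (dual D)) #|~: B|.
Proof.
move=> Dm BD; have Dm' := matroid_dual Dm; have fB := facet_dual Dm BD.
apply: krull_dim_face_ideal => [||G GD]; first by case: Dm'.
  exact: facet_mem.
exact: (leq_card_facet Dm' fB GD).
Qed.

End DualMatroid.

(** * Hilbert series of matroids of rank two *)

Import Order.TTheory Num.Theory.

Definition eq_mod (M : nat) (p q : {poly int}) : Prop :=
  forall i, (i < M)%N -> p`_i = q`_i.

Lemma eq_mod_mul M p p' q q' :
  eq_mod M p p' -> eq_mod M q q' -> eq_mod M (p * q) (p' * q').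
Proof.
move=> pp' qq' i iM; rewrite !coefM; apply: eq_bigr => j _.
by rewrite pp' ?qq' //; [apply: leq_ltn_trans (leq_subr _ _) iM|apply:
  leq_trans iM].
Qed.

Section BoxSeries.
Variable n : nat.
Implicit Types (D P : {set {set 'I_n}}) (C U F : {set 'I_n}).

(* A monomial with all exponents below M is encoded by a finite function, so
   that a Hilbert series becomes, modulo 'X^M, a product over the variables. *)
Definition box_supp M (u : {ffun 'I_n -> 'I_M}) : {set 'I_n} :=
  [set j | (u j : nat) != 0%N].

Definition box_series M (Q : pred {set 'I_n}) : {poly int} :=
  \sum_(u : {ffun 'I_n -> 'I_M} | Q (box_supp u)) 'X^(\sum_j u j)%N.

Lemma coef_box_series M Q i : (box_series M Q)`_i =
  (#|[set u : {ffun 'I_n -> 'I_M} | Q (box_supp u) && (\sum_j u j == i)%N]|)%:Z.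
Proof.
rewrite coef_sum -natz -sum1_card natr_sum big_mkcond [RHS]big_mkcond /=;
  apply: eq_bigr => u _.
rewrite inE coefXn eq_sym; case: (Q _) => //=; by case: eqP.
Qed.

Lemma dim_component_face (k : fieldType) D M i : (i < M)%N ->
  dim_component (face_ideal (k := k) D) i
    #|[set u : {ffun 'I_n -> 'I_M} | (box_supp u \in D) && (\sum_j u j ==
      i)%N]|.
Proof.
move=> iM; set S := [set u | _].
pose mon (u : {ffun 'I_n -> 'I_M}) : 'X_{1..n} := [multinom (u j : nat) | j <
  n].
have mon_supp u : supp (mon u) = box_supp u.
  by apply/setP => j; rewrite !inE mnmE.
have mon_deg u : mdeg (mon u) = (\sum_j u j)%N.
  by rewrite mdegE; apply: eq_bigr => j _; rewrite mnmE.
have mon_inj : injective mon.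
  move=> u v /mnmP uv; apply/ffunP => j; apply/val_inj.
  by have := uv j; rewrite !mnmE.
rewrite cardE -(size_map mon); apply: dim_component_monomial_ideal.
  by rewrite map_inj_uniq ?enum_uniq.
move=> m; apply/mapP/andP => [[u]|[mD /eqP mi]].
  by rewrite mem_enum inE => /andP[uD /eqP ui] ->; rewrite mon_supp mon_deg ui.
have m_lt j : (m j < M)%N.
  by apply: leq_ltn_trans iM; rewrite -mi mdegE (bigD1 j) //= leq_addr.
pose u : {ffun 'I_n -> 'I_M} := [ffun j => Ordinal (m_lt j)].
have mE : m = mon u by apply/mnmP => j; rewrite mnmE ffunE.
exists u => //; rewrite mem_enum inE -mon_supp -mE mD.
by rewrite -mon_deg -mE mi /=.
Qed.

(** The series factors over the variables: 1 for j in C, t/(1 - t) for j in U, and 1/(1 - t)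
    otherwise, each up to the truncation at t^M. *)
Lemma box_series_product M C U : (0 < M)%N -> [disjoint U & C] ->
  eq_mod M ((1 - 'X) ^+ #|~: C| *
              box_series M (fun F => [disjoint F & C] && (U \subset F)))
    'X^(#|U|).
Proof.
move=> M0 UC.
pose q (j : 'I_n) (v : 'I_M) :=
  if j \in C then (v == 0 :> nat) else (j \in U) ==> (v != 0 :> nat).
have -> : box_series M (fun F => [disjoint F & C] && (U \subset F)) =
    \prod_j \sum_(v | q j v) 'X^v.
  rewrite bigA_distr_big_dep; apply: eq_big => [u|u _];
    last by rewrite expr_sum.
  apply/andP/familyP => [[uC /subsetP uU] j|uq].
    rewrite unfold_in /q; case: ifP => jC.
      by have := disjointFl uC jC; rewrite inE => /negbFE.
    by apply/implyP => /uU; rewrite inE.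
  split; last first.
    apply/subsetP => j jU; have := uq j;
      rewrite unfold_in /q (disjointFr UC jU) jU.
    by rewrite inE.
  rewrite -setI_eq0; apply/eqP/setP => j; rewrite !inE;
    apply/negP => /andP[uj jC].
  by have := uq j; rewrite unfold_in /q jC (negPf uj).
have -> : (1 - 'X) ^+ #|~: C| = \prod_j (if j \in C then 1 else 1 - 'X) :>
  {poly int}.
  rewrite -prodr_const big_mkcond; apply: eq_bigr => j _.
  by rewrite inE; case: (j \in C).
have -> : 'X^(#|U|) = \prod_j (if j \in U then 'X else 1) :> {poly int}.
  by rewrite -big_mkcond prodr_const.
rewrite -big_split; apply: (big_ind2 (eq_mod M)) =>
  //= [p p' q' q'' pp' qq'|j _].
  exact: eq_mod_mul.
have geo : (1 - 'X) * \sum_(v < M) 'X^v = 1 - 'X^M :> {poly int}.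
  by rewrite -opprB mulNr -subrX1 opprB.
rewrite /q; case: ifP => jC.
  rewrite (disjointFl UC jC) mul1r.
  by rewrite (big_pred1 (Ordinal M0)) ?expr0.
case: ifP => jU /=; move=> i iM.
  rewrite (eq_bigl (fun v : 'I_M => v != Ordinal M0)) //.
  move: geo; rewrite (bigD1 (Ordinal M0)) //= expr0.
  set S := \sum_(v < M | _) _ => geo.
  have -> : (1 - 'X) * S = (1 - 'X) * (1 + S) - (1 - 'X) by ring.
  have -> : (1 - 'X) * (1 + S) - (1 - 'X) = 'X - 'X^M by rewrite geo; ring.
  by rewrite coefB coefXn (ltn_eqF iM) subr0.
by rewrite geo coefB coefXn (ltn_eqF iM) subr0.
Qed.

(** For C the coloops and P the parallel classes of the rank 2 contraction, the second condition
    leaves room outside F for two elements of distinct classes. *)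
Definition block_family C P : {set {set 'I_n}} :=
  [set F : {set 'I_n} | [disjoint F & C]
                         && (1 < #|[set A in P | ~~ (A \subset F)]|)%N].

(** Case split on the number of blocks not contained in F. With none, the right side is 1 - |P| +
    |P| - 1 = 0; with exactly one, only that block contributes to the sum; with more, only the
    constant 1 survives. *)
Lemma block_indicator P F : (0 < #|P|)%N ->
  (1 < #|[set A in P | ~~ (A \subset F)]|)%N%:R =
  1 - \sum_(A in P) (cover (P :\ A) \subset F)%:R
    + (#|P|%:R - 1) * (cover P \subset F)%:R :> int.
Proof.
move=> P0; set N := [set A in P | _].
have coverE A : (cover (P :\ A) \subset F) = (N \subset [set A]).
  apply/bigcupsP/subsetP => [PF B|NA B].
    rewrite !inE => /andP[BP]; apply: contraR => BA.
    by apply: PF; rewrite !inE BA.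
  rewrite !inE => /andP[BA BP]; apply: contraR BA => BF.
  by have := NA B; rewrite !inE BP BF => /(_ isT).
have cover0 : (cover P \subset F) = (N == set0).
  apply/bigcupsP/eqP => [PF|N0 B BP].
    apply/setP => B; rewrite !inE; apply/negP => /andP[BP].
    by rewrite PF.
  apply/negPn/negP => BF; have : B \in N by rewrite inE BP.
  by rewrite N0 inE.
rewrite cover0; under eq_bigr do rewrite coverE.
have [->|N0] := eqVneq N set0.
  under eq_bigr do rewrite sub0set.
  rewrite sumr_const cards0 ltn0 /=; ring.
have [N1|N1] := leqP #|N| 1.
  have /cards1P[B NB] : #|N| == 1%N by rewrite eqn_leq N1 card_gt0.
  have BP : B \in P by have : B \in N by [rewrite NB set11];
    rewrite inE => /andP[].
  rewrite (bigD1 B) //= NB subxx big1 => [|A /andP[_ AB]].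
    by rewrite addr0 mulr0 addr0 subrr.
  by rewrite sub1set inE eq_sym (negPf AB).
rewrite big1 => [|A _]; first by rewrite subr0 mulr0 addr0.
case: (boolP (N \subset [set A])) => // /subset_leq_card; rewrite cards1.
by rewrite leqNgt N1.
Qed.

Lemma box_seriesE M (Q : pred {set 'I_n}) :
  box_series M Q = \sum_(u : {ffun 'I_n -> 'I_M})
     ((Q (box_supp u))%:R : int) *: 'X^(\sum_j u j)%N.
Proof.
rewrite /box_series big_mkcond; apply: eq_bigr => u _.
by case: (Q _); rewrite ?scale1r ?scale0r.
Qed.

(* The numerator, over (1 - t) ^ #|~: C|, of the Hilbert series of an algebra
   whose standard monomials are those with support in [block_family C P]. *)
Definition block_poly P : {poly int} :=
  1 - \sum_(A in P) 'X^(#|cover (P :\ A)|) + (#|P|%:R - 1) *: 'X^(#|cover P|).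

Lemma eq_mod_sum M (J : finType) (Q : pred J) (f g : J -> {poly int}) :
  (forall j, Q j -> eq_mod M (f j) (g j)) ->
  eq_mod M (\sum_(j | Q j) f j) (\sum_(j | Q j) g j).
Proof. by move=> fg i iM; rewrite !coef_sum; apply: eq_bigr => j /fg ->. Qed.

(** Summing [block_indicator] over the exponent vectors splits the series into pieces that
    [box_series_product] evaluates. *)
Lemma block_series M C P : (0 < M)%N -> (0 < #|P|)%N -> [disjoint cover P & C]
  ->
  eq_mod M ((1 - 'X) ^+ #|~: C| * box_series M (mem (block_family C P)))
    (block_poly P).
Proof.
move=> M0 P0 PC.
pose W U := box_series M (fun F => [disjoint F & C] && (U \subset F)).
have W_coef U : U \subset cover P -> eq_mod M ((1 - 'X) ^+ #|~: C| * W U)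
  'X^(#|U|).
  by move=> UP; apply: box_series_product => //; apply: disjointWl PC.
have -> : box_series M (mem (block_family C P)) =
    W set0 - \sum_(A in P) W (cover (P :\ A)) + (#|P|%:R - 1) *: W (cover P).
  rewrite {1}/W !box_seriesE.
  under [\sum_(A in P) _]eq_bigr do rewrite /W box_seriesE.
  rewrite exchange_big /W box_seriesE scaler_sumr -sumrB -big_split.
  apply: eq_bigr => u _ /=; rewrite -scaler_suml scalerA -scalerBl -scalerDl.
  congr (_ *: _); rewrite inE sub0set andbT; case: [disjoint _ & _] => /=.
    exact: block_indicator.
  by rewrite big1 // mulr0 subr0 addr0.
have PD A : cover (P :\ A) \subset cover P.
  by apply/bigcupsP => B; rewrite inE => /andP[_ BP]; apply: bigcup_sup.
move=> i iM; rewrite mulrDr mulrBr [_ * \sum_(A in P) _]mulr_sumr -scalerAr.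
rewrite !coefD !coefN !coefZ (W_coef set0) ?sub0set // (W_coef (cover P)) //.
rewrite cards0 expr0; congr (_ - _ + _).
apply: eq_mod_sum iM => A _; exact: W_coef.
Qed.

End BoxSeries.

Lemma coef_1subX_mul (p : {poly int}) i :
  ((1 - 'X) * p)`_i = p`_i - (if i is j.+1 then p`_j else 0).
Proof. by rewrite mulrBl mul1r coefB coefXM; case: i. Qed.

Lemma coef_second_difference (g : nat -> nat) M i : (i.+2 < M)%N ->
  ((1 - 'X) ^+ 2 * hilbert_poly g M)`_i.+2 =
    (g i.+2)%:Z - 2 * (g i.+1)%:Z + (g i)%:Z.
Proof.
move=> iM; rewrite exprS expr1 -mulrA !coef_1subX_mul !coef_poly iM.
by rewrite (ltnW iM) (ltnW (ltnW iM)); ring.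
Qed.

Lemma coef_1subX_exp d : ((1 - 'X) ^+ d : {poly int})`_0 = 1 /\
  ((1 - 'X) ^+ d : {poly int})`_1 = - d%:Z.
Proof.
elim: d => [|d [IH0 IH1]]; first by rewrite expr0 !coef1.
by rewrite exprS !coef_1subX_mul IH0 IH1; split; lia.
Qed.

Lemma eq_mod_1subX_cancel M (p q : {poly int}) :
  eq_mod M ((1 - 'X) * p) ((1 - 'X) * q) -> eq_mod M p q.
Proof.
move=> pq; elim=> [|i IHi] iM; have := pq _ iM; rewrite !coef_1subX_mul.
  by rewrite !subr0.
by rewrite (IHi (ltnW iM)) => /addIr.
Qed.

Section HilbertSeries.
Variables (k : fieldType) (n : nat) (D : {set {set 'I_n}}) (HF : nat -> nat).
Hypotheses (Dsc : simplicial_complex D)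
  (HFP : forall i, dim_component (face_ideal (k := k) D) i (HF i)).

Lemma face_ideal_HF0 : HF 0%N = 1%N.
Proof.
have [II _] := homogeneous_monomial_ideal k (divisor_closed_face Dsc).
apply: (dim_component_uniq II (HFP 0%N)).
apply: (@dim_component_monomial_ideal _ _ _ _ [:: 0%MM]) => // m.
rewrite inE mdeg_eq0 andbC; case: eqP => //= ->.
have -> : supp (0%MM : 'X_{1..n}) = set0; last by case: Dsc => ->.
by apply/setP => i; rewrite !inE mnm0E.
Qed.

Lemma face_ideal_HF1 : HF 1%N = #|[set i | [set i] \in D]|.
Proof.
have [II _] := homogeneous_monomial_ideal k (divisor_closed_face Dsc).
apply: (dim_component_uniq II (HFP 1%N));
  rewrite cardE -(size_map (fun i => U_(i)%MM)).
have suppU (i : 'I_n) : supp U_(i)%MM = [set i].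
  by apply/setP => j; rewrite !inE mnm1E eqb0 negbK eq_sym.
apply: dim_component_monomial_ideal.
  rewrite map_inj_uniq ?enum_uniq // => i j /eqP.
  by rewrite eq_mnm1 => /eqP.
move=> m; apply/mapP/andP => [[i]|[mD /mdeg1P[i /eqP mi]]].
  by rewrite mem_enum inE => iD ->; rewrite suppU mdeg1.
by exists i => //; rewrite mem_enum inE -suppU -mi.
Qed.

Lemma face_ideal_hilbert_poly M :
  eq_mod M (hilbert_poly HF M) (box_series M (mem D)).
Proof.
have [II _] := homogeneous_monomial_ideal k (divisor_closed_face Dsc).
move=> i iM; rewrite coef_poly iM coef_box_series; congr Posz.
exact: dim_component_uniq II (HFP i) (dim_component_face k D iM).
Qed.

Lemma block_hilbert_poly M (C : {set 'I_n}) (P : {set {set 'I_n}}) : (0 <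
  #|P|)%N -> [disjoint cover P & C] ->
  D = block_family C P ->
  eq_mod M ((1 - 'X) ^+ #|~: C| * hilbert_poly HF M) (block_poly P).
Proof.
move=> P0 PC DE i iM; have M0 : (0 < M)%N by apply: leq_ltn_trans iM.
rewrite -(block_series M0 P0 PC iM) -DE.
by apply: eq_mod_mul iM => //; apply: face_ideal_hilbert_poly.
Qed.

End HilbertSeries.

(** * Matroids of rank two up to coloops *)

Section Rank2Blocks.
Variables (n : nat) (D : {set {set 'I_n}}).
Hypothesis Dm : matroid D.

Definition coloops : {set 'I_n} := [set i | [forall B, facet D B ==> (i \in
  B)]].

Lemma coloops_sub B : facet D B -> coloops \subset B.
Proof.
move=> BD; apply/subsetP => i; rewrite inE => /forallP/(_ B).
by rewrite BD.
Qed.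

Lemma set1_dual i : ([set i] \in dual D) = (i \notin coloops).
Proof.
rewrite inE [in RHS]inE negb_forall; apply: eq_existsb => B.
by rewrite negb_imply disjoints1.
Qed.

Variable B0 : {set 'I_n}.
Hypotheses (B0D : facet D B0) (card_B0 : #|B0| = #|coloops|.+2).

Let C := coloops.
Let E := [set i | (i \notin C) && (i |: C \in D)].
Let R i j := ~~ facet D (C :|: [set i; j]).

(* The parallel classes of the contraction of D by its coloops, a matroid of
   rank 2. *)
Definition parallel_classes : {set {set 'I_n}} := equivalence_partition R E.

Lemma facet_pair B : facet D B ->
  exists i j, [/\ i \in E, j \in E, ~~ R i j & B = C :|: [set i; j]].
Proof.
move=> BD; have CB := coloops_sub BD; have BDm := facet_mem BD.
have [[_ Dsub] _] := Dm.
have /cards2P[i [j [ij BC]]] : #|B :\: C| == 2%N.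
  by rewrite cardsD (setIidPr CB) (card_facet Dm BD B0D) card_B0 -addn2 addKn.
have BE : B = C :|: [set i;
  j] by rewrite -BC setDE setUIr setUCr setIT (setUidPr CB).
have BCE x : x \in B :\: C -> x \in E.
  rewrite !inE => /andP[xC xB]; rewrite xC; apply: Dsub BDm _.
  by rewrite subUset sub1set xB.
exists i, j; split=> //; rewrite ?BCE ?BC ?inE ?eqxx ?orbT //.
by rewrite /R -BE BD.
Qed.

Lemma mem_nonloop i : (i \in E) = (i \notin C) && (i |: C \in D).
Proof. by rewrite inE. Qed.

Lemma parallel_refl i : R i i.
Proof.
apply/negP => iD; have := card_facet Dm iD B0D; rewrite setUid card_B0 -/C.
have := leq_card_setU C [set i]; rewrite cards1 -/C => -[+ _] => le eqC; lia.
Qed.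

(** For transitivity, if C with i and l were a basis, exchange would extend C with j to a basis by i
    or by l, against [R i j] or [R j l]. *)
Lemma parallel_equivalence : {in E & &, equivalence_rel R}.
Proof.
have R_trans i j l : i \in E -> j \in E -> l \in E -> R i j -> R j l -> R i l.
  rewrite !mem_nonloop => /andP[iC iD] /andP[jC jD] /andP[lC lD] Rij Rjl.
  apply/negP => ilD; have := card_facet Dm ilD B0D; rewrite card_B0 => card_il.
  have card_jC : #|j |: C| = #|C|.+1 by rewrite cardsU1 jC.
  have [_ exch] := Dm; have [|x] := exch _ _ jD (facet_mem ilD).
    by rewrite card_il card_jC.
  rewrite in_setD in_setU1 negb_or => /andP[/andP[xj xC]].
  rewrite in_setU (negPf xC) in_set2 /= => xil xD.
  have : facet D (x |: (j |: C)).
    apply: (facet_card Dm B0D xD).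
    by rewrite cardsU1 in_setU1 negb_or xj xC card_jC card_B0.
  have -> : x |: (j |: C) = C :|: [set j; x].
    by apply/setP => y; rewrite !(in_setU, in_set1) orbA orbC [(y == x) ||
      _]orbC.
  by apply/negP; case/orP: xil => /eqP -> //; rewrite [[set j; i]]setUC.
have R_sym i j : R i j = R j i by rewrite /R [[set i; j]]setUC.
move=> i j l iE jE lE; split=> [|Rij]; first exact: parallel_refl.
by apply/idP/idP => H; [apply: (R_trans j i l) H;
  rewrite // R_sym | apply: (R_trans i j l) H].
Qed.

Lemma parallel_partition : partition parallel_classes E.
Proof. exact/equivalence_partitionP/parallel_equivalence. Qed.

(** The bases of D consist of the coloops and two elements from distinct parallel classes. *)
Lemma dual_block_family : dual D = block_family coloops parallel_classes.
Proof.
have /and3P[/eqP covP trivP _] := parallel_partition.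
have inP i j : i \in E -> j \in E -> (j \in pblock parallel_classes i) = R i j.
  exact: (pblock_equivalence_partition parallel_equivalence).
have pbP i : i \in E -> pblock parallel_classes i \in parallel_classes.
  by move=> iE; apply: pblock_mem; rewrite covP.
have self i : i \in E -> i \in pblock parallel_classes i.
  by move=> iE; rewrite mem_pblock covP.
apply/setP => F; rewrite [RHS]inE; apply/mem_dual/andP => [[B BD FB]|[FC]].
  have [i [j [iE jE Rij BE]]] := facet_pair BD.
  split; first exact: disjointWr (coloops_sub BD) FB.
  apply/card_gt1P; exists (pblock parallel_classes i), (pblock parallel_classes
    j).
  have inB x : x \in [set i; j] -> x \notin F.
    by move=> xij; rewrite (disjointFl FB) // BE inE xij orbT.
  split; last 1 first.
  - apply: contra Rij => /eqP ij; rewrite -inP // ij; exact: self.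
  - rewrite inE pbP //; apply/subsetPn; exists i; first exact: self.
    by apply: inB; rewrite !inE eqxx.
  - rewrite inE pbP //; apply/subsetPn; exists j; first exact: self.
    by apply: inB; rewrite !inE eqxx orbT.
case/card_gt1P => A [A' []]; rewrite !inE.
move=> /andP[AP /subsetPn[i iA iF]] /andP[A'P /subsetPn[j jA' jF]] AA'.
have iE : i \in E by rewrite -covP; apply/bigcupP; exists A.
have jE : j \in E by rewrite -covP; apply/bigcupP; exists A'.
exists (C :|: [set i; j]).
  apply/negPn/negP => Rij; case/eqP: AA'.
  rewrite -(def_pblock trivP AP iA) -(def_pblock trivP A'P jA').
  by apply/esym/same_pblock => //; rewrite inP //; apply/negPn/negP.
rewrite disjoint_sym -setI_eq0 setIUl setU_eq0 !setI_eq0 disjoint_sym FC /=.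
by rewrite -setI_eq0; apply/eqP/setP => x; rewrite !inE; apply/negP =>
  /andP[/orP[]/eqP->]; apply/negP.
Qed.

Lemma parallel_classes_gt0 : (0 < #|parallel_classes|)%N.
Proof.
have /and3P[/eqP covP _ _] := parallel_partition.
have [i [j [iE _ _ _]]] := facet_pair B0D.
by move: iE; rewrite -covP => /bigcupP[A AP _]; apply/card_gt0P; exists A.
Qed.

Lemma parallel_classes_disjoint : [disjoint cover parallel_classes & coloops].
Proof.
have /and3P[/eqP -> _ _] := parallel_partition.
rewrite -setI_eq0; apply/eqP/setP => i; rewrite !inE; apply/negP.
by case/andP=> /andP[/negP].
Qed.

End Rank2Blocks.

(** Away from these two degrees only the subtracted sum contributes. *)
Lemma block_poly_le0 n (P : {set {set 'I_n}}) j : j != 0%N ->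
  j != #|cover P| -> (block_poly P)`_j <= 0.
Proof.
move=> j0 jN; rewrite coefD coefB coef1 coefZ coefXn coef_sum (negPf j0) (negPf
  jN).
rewrite sub0r mulr0 addr0 oppr_le0; apply: sumr_ge0 => A _.
by rewrite coefXn ler0n.
Qed.

Theorem matroid_concave (k : fieldType) (n : nat) (D : {set {set 'I_n}})
    (s : nat) (h : seq nat) :
  matroid D -> size h = s.+1 -> (0 < nth 0%N h s)%N -> nth 0%N h 1 = 2%N ->
  h_vector (cover_ideal (k := k) D) h ->
  forall i, (i < s)%N ->
    (nth 0%N h i + nth 0%N h i.+2 <= nth 0%N h i.+1 + nth 0%N h i.+1)%N.
Proof.
move=> Dm size_h hs0 h1.
move/(h_vector_ext (fun p => cover_face_ideal D p)) => [d [HF [dimI HFP hE]]].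
have [[D0 _] _] := Dm; have [B0 B0D _] := sub_facet D0.
have Dsc' : simplicial_complex (dual D) by case: (matroid_dual Dm).
have dE : d = #|~: B0| := krull_dim_uniq dimI (krull_dim_dual k Dm B0D).
have hP M : eq_mod M ((1 - 'X) ^+ d * hilbert_poly HF M) (hilbert_poly (nth 0%N
  h) M).
  by move=> m mM; rewrite coef_hilbert_poly // hE coef_poly mM.
(* The coefficient of t gives 2 = h_1 = HF 1 - d, and HF 1 counts the elements that are not
   coloops. *)
have dC : (d.+2 = #|~: coloops D|)%N.
  have := hE 1%N; rewrite big_ord_recl big_ord1 subn0 subnn h1.
  have [-> ->] := coef_1subX_exp d.
  rewrite (face_ideal_HF0 Dsc' HFP) (face_ideal_HF1 Dsc' HFP).
  have -> : #|[set i | [set i] \in dual D]| = #|~: coloops D|.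
    by apply: eq_card => i; rewrite inE set1_dual in_setC.
  lia.
have card_B0 : #|B0| = #|coloops D|.+2.
  have := cardsC B0; have := cardsC (coloops D); rewrite -dE -dC; lia.
have hB M : eq_mod M ((1 - 'X) ^+ 2 * hilbert_poly (nth 0%N h) M)
    (block_poly (parallel_classes D)).
  move=> m mM.
  rewrite -(block_hilbert_poly Dsc' HFP _ _ (dual_block_family Dm B0D card_B0)
    mM).
  - rewrite -dC -[d.+2]addn2 exprD [_ ^+ d * _]mulrC -[in RHS]mulrA.
    exact/esym/(eq_mod_mul (p := (1 - 'X) ^+ 2) (fun _ _ => erefl) (hP M) mM).
  - exact: parallel_classes_gt0 B0D card_B0.
  - exact: parallel_classes_disjoint B0D card_B0.
(* The second difference of h at s + 2 is h_s > 0, and a positive coefficient in positive degree can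
   only occur at the size of the cover. *)
have NE : s.+2 = #|cover (parallel_classes D)|.
  apply/eqP/negPn/negP => sN; have := block_poly_le0 (isT : s.+2 != 0%N) sN.
  rewrite -(hB s.+3) // coef_second_difference //.
  by rewrite [nth _ _ s.+2]nth_default ?[nth _ _ s.+1]nth_default ?size_h //;
    lia.
move=> i i_s; have iN : i.+2 != #|cover (parallel_classes D)|.
  by rewrite -NE !eqSS ltn_eqF.
have := block_poly_le0 (isT : i.+2 != 0%N) iN.
by rewrite -(hB i.+3) // coef_second_difference //; lia.
Qed.

(** * The matroid of rank two with prescribed parallel classes *)

Section Rank2Matroid.
Variables (n : nat) (L : finType) (cl : 'I_n -> L).

(** The loopless matroid of rank at most two whose parallel classes are the nonempty fibres of [cl];
    the equality of cardinals encodes injectivity of [cl] on F. *)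
Definition rank2_matroid : {set {set 'I_n}} :=
  [set F : {set 'I_n} | (#|F| <= 2)%N && (#|cl @: F| == #|F|)].

Definition parallel_class (l : L) : {set 'I_n} := [set i | cl i == l].

Lemma rank2_matroidP (F : {set 'I_n}) :
  reflect ((#|F| <= 2)%N /\ {in F &, injective cl}) (F \in rank2_matroid).
Proof. by rewrite inE; apply: (iffP andP) => -[F2 /imset_injP]. Qed.

Lemma matroid_rank2 : matroid rank2_matroid.
Proof.
split=> [|F G /rank2_matroidP[F2 Finj] /rank2_matroidP[G2 Ginj] FG].
  split=> [|F G /rank2_matroidP[F2 Finj] GF].
    by apply/rank2_matroidP; rewrite cards0; split=> // x y; rewrite inE.
  apply/rank2_matroidP; split; first exact: leq_trans (subset_leq_card GF) F2.
  by move=> x y xG yG; apply: Finj; apply: (subsetP GF).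
have [i iG iF] : exists2 i, i \in G & cl i \notin cl @: F.
  have /subsetPn[l /imsetP[i iG ->] iF] : ~~ (cl @: G \subset cl @: F).
    apply: contraL FG => /subset_leq_card; rewrite -leqNgt.
    by rewrite !card_in_imset.
  by exists i.
have iF' : i \notin F by apply: contra iF; apply: imset_f.
exists i; first by rewrite inE iF' iG.
apply/rank2_matroidP; split; first by rewrite cardsU1 iF' (leq_trans FG).
have clF x : x \in F -> cl x != cl i by move=> xF; apply: contraNneq iF => <-;
  apply: imset_f.
move=> x y /setU1P[->|xF] /setU1P[->|yF] // eq_cl; last exact: Finj.
  by have := clF y yF; rewrite eq_cl eqxx.
by have := clF x xF; rewrite eq_cl eqxx.
Qed.

Hypotheses (L2 : (1 < #|L|)%N) (cl_onto : forall l, exists i, cl i = l).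

Lemma facet_pair_rank2 i j : cl i != cl j -> facet rank2_matroid [set i; j].
Proof.
move=> ij; have ij' : i != j by apply: contraNneq ij => ->.
apply/maxsetP; split.
  apply/rank2_matroidP; split; first by rewrite cards2 ij'.
  move=> x y /set2P[]-> /set2P[]-> // eq_cl; move: ij; rewrite eq_cl ?eqxx //.
move=> B /rank2_matroidP[B2 _] ijB; apply/esym/eqP.
by rewrite eqEcard ijB cards2 ij'.
Qed.

Lemma exists_facet_rank2 : exists i j, cl i != cl j.
Proof.
have /card_gt1P[l [l' [_ _ ll']]] := L2.
by have [[i il] [j jl']] := (cl_onto l, cl_onto l'); exists i, j;
  rewrite il jl'.
Qed.

Lemma facet_rank2 B : facet rank2_matroid B ->
  exists i j, cl i != cl j /\ B = [set i; j].
Proof.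
move=> BD; have [i0 [j0 ij0]] := exists_facet_rank2.
have := card_facet matroid_rank2 BD (facet_pair_rank2 ij0).
have ij0' : i0 != j0 by apply: contraNneq ij0 => ->.
rewrite cards2 ij0' => /eqP/cards2P[i [j [ij BE]]].
exists i, j; split=> //; apply: contra ij => /eqP eq_cl.
have /rank2_matroidP[_ Binj] := facet_mem BD.
by apply/eqP/Binj; rewrite ?BE ?inE ?eqxx ?orbT.
Qed.

Lemma parallel_class_inj : injective parallel_class.
Proof.
move=> l l' /setP ll'; have [i il] := cl_onto l.
by have := ll' i; rewrite !inE il eqxx => /esym/eqP.
Qed.

Let P := parallel_class @: [set: L].

(** The bases are the pairs with distinct labels. The empty set stands in the place of the coloops,
    as the blocks are classes of the whole matroid and not of a contraction. *)
Lemma dual_rank2_matroid : dual rank2_matroid = block_family set0 P.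
Proof.
apply/setP => F; rewrite [RHS]inE -setI_eq0 setI0 eqxx /=.
apply/mem_dual/card_gt1P => [[B /facet_rank2[i [j [ij ->]]] Fij]|].
  have inB x : x \in [set i; j] -> x \notin F by move=> xij;
    rewrite (disjointFl Fij).
  exists (parallel_class (cl i)), (parallel_class (cl j)).
  split; last by rewrite (inj_eq parallel_class_inj).
    rewrite inE imset_f ?inE //; apply/subsetPn; exists i; rewrite ?inE //.
    by apply: inB; rewrite !inE eqxx.
  rewrite inE imset_f ?inE //; apply/subsetPn; exists j; rewrite ?inE //.
  by apply: inB; rewrite !inE eqxx orbT.
case=> A [A' []]; rewrite !inE => /andP[/imsetP[l _ ->] /subsetPn[i il iF]].
move=> /andP[/imsetP[l' _ ->] /subsetPn[j jl' jF]] ll'.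
move: il jl'; rewrite !inE => /eqP il /eqP jl'; exists [set i; j].
  by apply: facet_pair_rank2; rewrite il jl'; apply: contraNneq ll' => ->.
rewrite -setI_eq0; apply/eqP/setP => x; rewrite !inE; apply/negP.
by case/andP=> xF /orP[]/eqP xE; move: xF; rewrite xE; apply/negP.
Qed.

Lemma block_poly_rank2 : block_poly P =
  1 - \sum_l 'X^(n - #|parallel_class l|) + (#|L|%:R - 1) *: 'X^n.
Proof.
have covP : cover P = setT.
  apply/setP => i; rewrite inE; apply/bigcupP; exists (parallel_class (cl i)).
    by rewrite imset_f ?inE.
  by rewrite inE.
rewrite /block_poly covP cardsT card_ord card_imset ?cardsT;
  last exact: parallel_class_inj.
congr (_ - _ + _); rewrite big_imset /=; last by move=> x y _ _;
  apply: parallel_class_inj.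
rewrite [LHS](eq_bigl predT); last by move=> l; rewrite inE.
apply: eq_bigr => l _; congr 'X^_.
rewrite (_ : cover _ = ~: parallel_class l).
  by apply: (canRL (addKn _)); rewrite cardsC card_ord.
apply/setP => i; rewrite in_setC; apply/bigcupP/idP => [[A]|il].
  rewrite in_setD1 => /andP[Al /imsetP[l' _ AE]]; subst A.
  rewrite !inE => /eqP ->; apply: contra Al => /eqP ->.
  by [].
exists (parallel_class (cl i)); last by rewrite inE.
rewrite in_setD1 imset_f ?inE // andbT (inj_eq parallel_class_inj).
by move: il; rewrite inE.
Qed.

Lemma card_coface_rank2 : exists2 B, facet rank2_matroid B & (#|~: B|.+2 = n)%N.
Proof.
have [i [j ij]] := exists_facet_rank2.
exists [set i; j]; first exact: facet_pair_rank2.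
have ij' : i != j by apply: contraNneq ij => ->.
by have := cardsC [set i; j]; rewrite cards2 ij' card_ord add2n.
Qed.

End Rank2Matroid.

(** The dependent pairs (l, x) with x below the l-th entry number [sumn a]; an enumeration of them
    labels each index by its first component. *)
Lemma exists_labelling (a : seq nat) :
  exists cl : 'I_(sumn a) -> 'I_(size a),
    forall l, #|parallel_class cl l| = nth 0%N a l.
Proof.
pose T := {l : 'I_(size a) & 'I_(nth 0%N a l)}.
have cardT : #|{: T}| = sumn a.
  rewrite card_tagged sumnE big_map big_enum /= [RHS]sumnE (big_nth 0%N)
    big_mkord.
  by apply: eq_bigr => l _; rewrite card_ord.
pose t i : T := enum_val (cast_ord (esym cardT) i).
pose g (x : T) := cast_ord cardT (enum_rank x).
have tg x : t (g x) = x by rewrite /t /g cast_ordK enum_rankK.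
have gt i : g (t i) = i by rewrite /t /g enum_valK cast_ordKV.
exists (fun i => tag (t i)) => l.
have -> : parallel_class (fun i => tag (t i)) l =
    [set g (Tagged (fun l : 'I_(size a) =>
      'I_(nth 0%N a l)) x) | x : 'I_(nth 0%N a l)].
  apply/setP => i; rewrite inE; apply/eqP/imsetP => [|[x _ ->]];
    last by rewrite tg.
  rewrite -{2}(gt i); case: (t i) => l' x /= ll'; subst l'; by exists x.
rewrite card_imset ?card_ord // => x y /(can_inj tg) /eqP.
by rewrite -tag_eqE /tag_eq eqxx tagged_asE => /eqP.
Qed.

(* By [aE], minus the second difference of h at i is the number of the parts of
   a that are equal to s + 2 - i. *)
Lemma coef_concave_partition (s M : nat) (h : nat -> nat) (a : seq nat) i :
  (0 < s)%N -> h 0%N = 1%N -> h 1%N = 2%N -> (forall t, (s < t)%N -> h t = 0%N)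
    ->
  all (fun x => 0 < x <= s)%N a -> size a = (h s).+1 ->
  (forall t, (t <= s.+1)%N -> (\sum_(x <- a) minn x t = t + h (s.+1 - t))%N) ->
  (i < M)%N ->
  (1 - \sum_(x <- a) 'X^(s.+2 - x) + ((size a)%:R - 1) *: 'X^(s.+2) : {poly
    int})`_i
    = ((1 - 'X) ^+ 2 * hilbert_poly h M)`_i.
Proof.
move=> s0 h0 h1 hs a_le size_a aE iM.
rewrite coefD coefB coef1 coefZ coefXn coef_sum.
pose c := (\sum_(x <- a) (i == s.+2 - x))%N.
have -> : \sum_(x <- a) ('X^(s.+2 - x) : {poly int})`_i = c%:Z.
  by rewrite -natz natr_sum; apply: eq_bigr => x _; rewrite coefXn.
have c0 : (forall x, (0 < x <= s)%N -> i != (s.+2 - x)%N) -> c = 0%N.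
  move=> ix; rewrite /c big_seq big1 // => x /(allP a_le)/ix.
  by case: eqP.
rewrite size_a; case: i iM @c c0 => [|[|i]] iM c c0.
- rewrite c0 => [|x /andP[x0 xs]]; last by apply/eqP; lia.
  by rewrite expr2 -mulrA !coef_1subX_mul coef_poly iM h0 /= mulr0 addr0 subr0.
- rewrite c0 => [|x /andP[x0 xs]]; last by apply/eqP; lia.
  by rewrite expr2 -mulrA !coef_1subX_mul !coef_poly iM (ltnW iM) h0 h1 /=
    mulr0.
rewrite coef_second_difference //.
(* For i = s both sides equal h s, and for i > s both vanish. *)
have [i_s|s_i] := ltnP i s; last first.
  rewrite c0 => [|x /andP[x0 xs]]; last by apply/eqP; lia.
  rewrite (hs i.+2) ?(hs i.+1) ?ltnS ?leqW //.
  move: s_i; rewrite leq_eqVlt => /predU1P[<-|s_i]; first by rewrite eqxx; lia.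
  by rewrite (hs i) // !eqSS gtn_eqF //; lia.
rewrite !eqSS (ltn_eqF i_s).
(* For t = s - i, twice min(x, t) exceeds min(x, t - 1) + min(x, t + 1) by one if x = t, and equals
   it otherwise. *)
have cE : (c + \sum_(x <- a) minn x (s - i).-1 + \sum_(x <- a) minn x (s -
  i).+1 =
           \sum_(x <- a) minn x (s - i) + \sum_(x <- a) minn x (s - i))%N.
  rewrite /c -!big_split big_seq [RHS]big_seq;
    apply: eq_bigr => x /(allP a_le) /=.
  by case: eqP; lia.
move: cE; rewrite !aE; try lia.
have -> : (s.+1 - (s - i).-1 = i.+2)%N by lia.
have -> : (s.+1 - (s - i).+1 = i)%N by lia.
have -> : (s.+1 - (s - i) = i.+1)%N by lia.
lia.
Qed.

Theorem concave_matroid (k : fieldType) (s : nat) (h : seq nat) :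
  (0 < s)%N -> size h = s.+1 -> (0 < nth 0%N h s)%N ->
  nth 0%N h 0 = 1%N -> nth 0%N h 1 = 2%N ->
  (forall i, (i < s)%N ->
    (nth 0%N h i + nth 0%N h i.+2 <= nth 0%N h i.+1 + nth 0%N h i.+1)%N) ->
  exists (n : nat) (D : {set {set 'I_n}}),
    matroid D /\ h_vector (stanley_reisner_ideal (k := k) D) h.
Proof.
move=> s0 size_h hs_gt0 h0 h1 hc.
have hs t : (s < t)%N -> nth 0%N h t = 0%N by move=> st;
  rewrite nth_default ?size_h.
have [a a_le [sum_a aE]] := concave_partition s0 h0 h1 (hs _ (ltnSn s)) hc.
(* All parts are positive, so [aE] at t = 1 counts them. *)
have size_a : size a = (nth 0%N h s).+1.
  have := aE 1%N isT.
  rewrite subSS subn0 add1n => <-; rewrite -sum1_size big_seq [RHS]big_seq.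
  by apply: eq_bigr => x /(allP a_le)/andP[x0 _]; rewrite (minn_idPr x0).
have [cl clE] := exists_labelling a; move: cl clE; rewrite sum_a => cl clE.
have L2 : (1 < #|'I_(size a)|)%N by rewrite card_ord size_a ltnS.
have cl_onto l : exists i, cl i = l.
  have /card_gt0P[i] : (0 < #|parallel_class cl l|)%N.
    by rewrite clE; have /andP[] := allP a_le _ (mem_nth 0%N (ltn_ord l)).
  by rewrite inE => /eqP il; exists i.
set D := rank2_matroid cl; have Dm : matroid D := matroid_rank2 cl.
have dDm := matroid_dual Dm; have [dDsc _] := dDm.
exists s.+2, (dual D); split=> //.
suff: h_vector (face_ideal (k := k) (dual D)) h.
  apply: h_vector_ext => p; apply: iff_sym.
  exact: stanley_reisner_face_ideal.
have [B BD cardB] := card_coface_rank2 L2 cl_onto.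
pose HF i := #|[set u : {ffun 'I_s.+2 -> 'I_i.+1} |
                 (box_supp u \in dual D) && (\sum_j u j == i)%N]|.
have HFP i : dim_component (face_ideal (k := k) (dual D)) i (HF i).
  exact: dim_component_face.
exists s, HF; split=> // [|m].
  by have := krull_dim_dual k Dm BD; case: cardB => ->.
rewrite -(@coef_hilbert_poly _ _ m.+1) //.
have -> : (nth 0%N h m)%:Z = (hilbert_poly (nth 0%N h) m.+1)`_m by rewrite
  coef_poly ltnSn.
(* The factor (1 - t)^2 raises the exponent from the dimension s to the number s + 2 of variables,
   as [block_hilbert_poly] requires. *)
apply: (@eq_mod_1subX_cancel m.+1) (ltnSn m);
  apply: eq_mod_1subX_cancel => i im.
have -> : (1 - 'X) * ((1 - 'X) * ((1 - 'X) ^+ s * hilbert_poly HF m.+1)) =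
    (1 - 'X) ^+ #|~: set0 : {set 'I_s.+2}| * hilbert_poly HF m.+1.
  by rewrite setC0 cardsT card_ord !exprS !mulrA.
have P_dual := dual_rank2_matroid L2 cl_onto.
rewrite (block_hilbert_poly dDsc HFP _ _ P_dual im).
- rewrite block_poly_rank2 //.
  have -> : \sum_l 'X^(s.+2 - #|parallel_class cl l|) =
      \sum_(x <- a) 'X^(s.+2 - x) :> {poly int}.
    by rewrite (big_nth 0%N) big_mkord; apply: eq_bigr => l _; rewrite clE.
  rewrite card_ord (coef_concave_partition s0 h0 h1 hs a_le size_a aE im).
  by rewrite expr2 mulrA.
- rewrite card_imset; last exact: parallel_class_inj cl_onto.
  by rewrite cardsT ltnW.
- by rewrite -setI_eq0 setI0.
Qed.

Theorem corollary2p11 (k : fieldType) (s : nat) (h : seq nat)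
    (s_ge1 : (1 <= s)%N) (size_h : size h = s.+1)
    (h_pos : forall i, (i <= s)%N -> (0 < nth 0%N h i)%N)
    (h0 : nth 0%N h 0 = 1%N) (h1 : nth 0%N h 1 = 2%N) :
  [<-> (* (i) *)
       exists (n : nat) (D : {set {set 'I_n}}),
         matroid D /\ h_vector (@stanley_reisner_ideal n k D) h;
       (* (ii) *)
       exists (n : nat) (D : {set {set 'I_n}}),
         matroid D /\ h_vector (@cover_ideal n k D) h;
       (* (iii) *)
       pure_O_sequence h;
       (* (iv) *)
       exists (n : nat) (I : {mpoly k[n]} -> Prop),
         level_algebra I /\ h_vector I h;
       (* (v) *)
       forall i, (1 <= i <= s)%N ->
         (nth 0%N h i.+1)%:Z
           <= 2 * (nth 0%N h i)%:Z - (nth 0%N h i.-1)%:Z].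
Proof.
have h_s : (0 < nth 0%N h s)%N := h_pos s (leqnn s).
tfae.
- case=> n [D [Dm hD]]; exists n, (dual D); split; first exact: matroid_dual.
  apply: h_vector_ext hD => p;
    apply: iff_trans (iff_sym (cover_face_ideal _ _)).
  by rewrite dualK //; apply: stanley_reisner_face_ideal; case: Dm.
(* This implication passes through concavity; the order ideal is rebuilt from h alone. *)
- case=> n [D [Dm hD]]; apply: (concave_pure_O_sequence s_ge1) => //.
  exact: matroid_concave Dm size_h h_s h1 hD.
- exact: pure_O_sequence_level.
- case=> n [I [I_level hI]] [//|i] i_s /=.
  by have := level_concave size_h h_pos h1 I_level hI i_s; lia.
- move=> hc; apply: (concave_matroid k s_ge1) => // i i_s.
  by have := hc i.+1 i_s => /=; lia.
Qed.
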